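(* Let $n\geqslant 4$, let $(\overline M,\bar g)$ be a $1$-dimensional manifold with $\bar g_{11}=\varepsilon=\pm1$, let $(\widetilde N,\tilde g)$ be an $(n-1)$-dimensional semi-Riemannian manifold which is not an Einstein manifold, let $F:\overline M\to\mathbb{R}^+$ be smooth, and let $\overline M\times_F\widetilde N$ be the warped product with metric $g$. Suppose that $$R\cdot C-C\cdot R=L\,Q(S,R)$$ holds on the set $U\subset\overline M\times_F\widetilde N$ of all points at which $Q(S,R)\neq0$, where $L$ is some function on $U$. Then there are $a,b\in\mathbb{R}$ such that on the set $\mathcal{U}=U\cap U_S\cap U_C$ we have $$L=\frac{1}{n-2},\qquad F(x^1)=(ax^1+b)^2,$$ and the fiber satisfies (on $\mathcal{U}$) $$\widetilde S_{\mu}{}^{\epsilon}\widetilde R_{\epsilon\beta\gamma\delta}=\frac{\tilde\kappa}{n-1}\,\widetilde R_{\mu\beta\gamma\delta}+\varepsilon a^2\bigl(\tilde g_{\beta\gamma}\widetilde S_{\mu\delta}-\tilde g_{\beta\delta}\widetilde S_{\mu\gamma}\bigr)-\frac{\varepsilon\tilde\kappa a^2}{n-1}\,\widetilde G_{\mu\beta\gamma\delta}.$$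
   Context: All manifolds are connected, paracompact and $C^\infty$. For a semi-Riemannian manifold $(M,g)$ of dimension $n$ with Levi-Civita connection $\nabla$ and a symmetric $(0,2)$-tensor $A$: $(X\wedge_AY)Z=A(Y,Z)X-A(X,Z)Y$; $\mathcal R(X,Y)Z=\nabla_X\nabla_YZ-\nabla_Y\nabla_XZ-\nabla_{[X,Y]}Z$; $S(X,Y)=\mathrm{tr}\{Z\mapsto\mathcal R(Z,X)Y\}$ is the Ricci tensor; the Ricci operator $\mathcal S$ is given by $g(\mathcal SX,Y)=S(X,Y)$; $\kappa=\mathrm{tr}\,\mathcal S$; $\mathcal C(X,Y)=\mathcal R(X,Y)-\frac{1}{n-2}\bigl(X\wedge_g\mathcal SY+\mathcal SX\wedge_gY-\frac{\kappa}{n-1}X\wedge_gY\bigr)$. The $(0,4)$-tensors are $G(X_1,X_2,X_3,X_4)=g((X_1\wedge_gX_2)X_3,X_4)$, $R(X_1,X_2,X_3,X_4)=g(\mathcal R(X_1,X_2)X_3,X_4)$, $C(X_1,X_2,X_3,X_4)=g(\mathcal C(X_1,X_2)X_3,X_4)$ (Weyl tensor). For $\mathcal B\in\{\mathcal R,\mathcal C\}$ with associated $(0,4)$-tensor $B\in\{R,C\}$ and a $(0,k)$-tensor $T$: $(B\cdot T)(X_1,\dots,X_k;X,Y)=-\sum_{i=1}^kT(X_1,\dots,\mathcal B(X,Y)X_i,\dots,X_k)$, and $Q(A,T)(X_1,\dots,X_k;X,Y)=-\sum_{i=1}^kT(X_1,\dots,(X\wedge_AY)X_i,\dots,X_k)$.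 $(M,g)$ is Einstein if $S=\frac{\kappa}{n}g$ at every point. $U_S=\{x: S\neq\frac{\kappa}{n}g\text{ at }x\}$, $U_C=\{x: C\neq0\text{ at }x\}$. The warped product $\overline M\times_F\widetilde N$ is $\overline M\times\widetilde N$ with metric $g=\pi_1^*\bar g+(F\circ\pi_1)\pi_2^*\tilde g$, $\pi_1,\pi_2$ being the projections. $R,S,C,\kappa$ refer to $g$; tensors with a tilde ($\widetilde R,\widetilde S,\widetilde G,\tilde\kappa$) are those of $(\widetilde N,\tilde g)$, and relations among them on a set in the product are understood via $\pi_2$. Considerations are local, in product charts; $x^1$ is the coordinate on $\overline M$ with $\bar g_{11}=\varepsilon$. Greek indices refer to the fiber, $\widetilde R_{\mu\beta\gamma\delta}=\widetilde R(\partial_\mu,\partial_\beta,\partial_\gamma,\partial_\delta)$, and $\widetilde S_\mu{}^\epsilon=\tilde g^{\epsilon\nu}\widetilde S_{\mu\nu}$. *)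

(* Defs.v *)
From HB Require Import structures.
From mathcomp Require Import all_boot all_order all_algebra.
From mathcomp Require Import all_classical all_reals all_analysis.

Set Implicit Arguments.
Unset Strict Implicit.
Unset Printing Implicit Defensive.

Import Order.TTheory GRing.Theory Num.Theory.
Import numFieldNormedType.Exports.

Local Open Scope classical_set_scope.
Local Open Scope ring_scope.

(** * Calculus in coordinates *)

(* [Ck k O f] is meant for open [O]: all iterated partial derivatives of [f]
   of order at most [k] exist and are continuous on [O]. *)
Fixpoint Ck (R : realType) (m k : nat) (O : set 'rV[R]_m) (f : 'rV[R]_m -> R)
    : Prop :=
  {in O, continuous f} /\
  (if k is k'.+1 then
     forall i : 'I_m,
       {in O, forall x, derivable f x (delta_mx 0 i)} /\
       Ck k' O (fun x => 'D_(delta_mx 0 i) f x)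
   else True).

Definition smooth_on (R : realType) (m : nat) (O : set 'rV[R]_m)
    (f : 'rV[R]_m -> R) : Prop :=
  forall k, Ck k O f.

(** * Semi-Riemannian manifolds *)

Definition paracompact (T : topologicalType) : Prop :=
  forall U : set (set T),
    (forall A, U A -> open A) -> (forall x, exists2 A, U A & A x) ->
    exists V : set (set T),
      [/\ forall B, V B -> open B,
          forall x, exists2 B, V B & B x,
          forall B, V B -> exists2 A, U A & B `<=` A &
          forall x : T, exists W : set T, nbhs x W /\
            finite_set [set B | V B /\ B `&` W !=set0]].

(* The values of [chart_coord] outside [chart_dom] and of [chart_param] outside
   [chart_img] carry no information. *)
Record chart (R : realType) (T : topologicalType) (m : nat) := Chart {
  chart_dom : set T;
  chart_coord : T -> 'rV[R]_m;
  chart_param : 'rV[R]_m -> T;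
  chart_dom_open : open chart_dom;
  chart_img_open : open (chart_coord @` chart_dom);
  chart_coordK : {in chart_dom, cancel chart_coord chart_param};
  chart_coord_continuous : {in chart_dom, continuous chart_coord};
  chart_param_continuous :
    {in chart_coord @` chart_dom, continuous chart_param} }.

Definition chart_img (R : realType) (T : topologicalType) (m : nat)
    (c : chart R T m) : set 'rV[R]_m :=
  chart_coord c @` chart_dom c.

Definition smooth_transition (R : realType) (T : topologicalType) (m : nat)
    (c d : chart R T m) : Prop :=
  forall k : 'I_m,
    smooth_on (chart_coord c @` (chart_dom c `&` chart_dom d))
              (fun u => chart_coord d (chart_param c u) 0 k).

Definition compatible (R : realType) (T : topologicalType) (m : nat)
    (c d : chart R T m) : Prop :=
  smooth_transition c d /\ smooth_transition d c.

(* A connected, Hausdorff, paracompact m-manifold with its maximal smooth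
   atlas.  The metric tensor is given by its component matrices
   [metric c u], [u] in the image of the chart [c].  Vectors are row vectors
   of components, and row i of [jacobian f u] is the i-th partial derivative of
   [f] at [u]; hence the form of the transformation law.  The index of the
   metric is constant because the manifold is connected. *)
Record semiRiemannian (R : realType) (m : nat) := SemiRiemannian {
  mf_point :> topologicalType;
  atlas : set (chart R mf_point m);
  metric : chart R mf_point m -> 'rV[R]_m -> 'M[R]_m;
  mf_connected : connected [set: mf_point];
  mf_hausdorff : hausdorff_space mf_point;
  mf_paracompact : paracompact mf_point;
  atlas_cover : forall p : mf_point, exists2 c, atlas c & chart_dom c p;
  atlas_compatible : forall c d, atlas c -> atlas d -> compatible c d;
  atlas_maximal :
    forall c, (forall d, atlas d -> compatible c d) -> atlas c;
  metric_smooth : forall c, atlas c -> forall i j,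
    smooth_on (chart_img c) (fun u => metric c u i j);
  metric_sym : forall c, atlas c -> forall u, chart_img c u ->
    (metric c u)^T = metric c u;
  metric_nondegenerate : forall c, atlas c -> forall u, chart_img c u ->
    metric c u \in unitmx;
  metric_transform : forall c d, atlas c -> atlas d ->
    forall p, chart_dom c p -> chart_dom d p ->
    let J := jacobian (chart_coord d \o chart_param c) (chart_coord c p) in
    metric c (chart_coord c p) = J *m metric d (chart_coord d p) *m J^T }.

Definition smooth_fun (R : realType) (m : nat) (M : semiRiemannian R m)
    (f : M -> R) : Prop :=
  forall c, atlas c -> smooth_on (chart_img c) (f \o chart_param c).

(** * Tensors of a metric [g] given on an open set of coordinates *)

Section Curvature.
Context (R : realType) (n : nat).
Implicit Types (g : 'rV[R]_n -> 'M[R]_n) (x u v w : 'rV[R]_n).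
Implicit Types (X Y Z : 'rV[R]_n -> 'rV[R]_n).

Definition inner g x u v : R := (u *m g x *m v^T) 0 0.

Definition christoffel g x (k i j : 'I_n) : R :=
  2^-1 * \sum_l invmx (g x) k l *
    ('D_(delta_mx 0 i) (fun y => g y j l) x
     + 'D_(delta_mx 0 j) (fun y => g y i l) x
     - 'D_(delta_mx 0 l) (fun y => g y i j) x).

Definition nabla g X Y x : 'rV[R]_n :=
  \row_k ('D_(X x) (fun y => Y y 0 k) x
          + \sum_i \sum_j christoffel g x k i j * X x 0 i * Y x 0 j).

Definition lie_bracket X Y x : 'rV[R]_n :=
  \row_k ('D_(X x) (fun y => Y y 0 k) x - 'D_(Y x) (fun y => X y 0 k) x).

Definition curv_field g X Y Z x : 'rV[R]_n :=
  nabla g X (nabla g Y Z) x - nabla g Y (nabla g X Z) x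
  - nabla g (lie_bracket X Y) Z x.

(* The curvature is a tensor, so its value at [x] is computed by extending
   the three vectors to fields with constant components. *)
Definition curv g x u v w : 'rV[R]_n :=
  curv_field g (fun=> u) (fun=> v) (fun=> w) x.

Definition wedge_op (A : 'rV[R]_n -> 'rV[R]_n -> R) u v w : 'rV[R]_n :=
  A v w *: u - A u w *: v.

Definition ricci g x u v : R := \tr (lin1_mx (fun z => curv g x z u v)).

Definition ricci_op g x u : 'rV[R]_n :=
  (\row_j ricci g x u (delta_mx 0 j)) *m invmx (g x).

Definition scalar_curv g x : R := \tr (lin1_mx (ricci_op g x)).

Definition weyl_op g x u v w : 'rV[R]_n :=
  curv g x u v w
  - (n%:R - 2)^-1 *:
    (wedge_op (inner g x) u (ricci_op g x v) w
     + wedge_op (inner g x) (ricci_op g x u) v w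
     - (scalar_curv g x / (n%:R - 1)) *: wedge_op (inner g x) u v w).

Definition tensor4 := 'rV[R]_n -> 'rV[R]_n -> 'rV[R]_n -> 'rV[R]_n -> R.

Definition G4 g x : tensor4 :=
  fun u1 u2 u3 u4 => inner g x (wedge_op (inner g x) u1 u2 u3) u4.
Definition R4 g x : tensor4 :=
  fun u1 u2 u3 u4 => inner g x (curv g x u1 u2 u3) u4.
Definition C4 g x : tensor4 :=
  fun u1 u2 u3 u4 => inner g x (weyl_op g x u1 u2 u3) u4.

Definition endo_act (E : 'rV[R]_n -> 'rV[R]_n) (T : tensor4) : tensor4 :=
  fun u1 u2 u3 u4 =>
    - (T (E u1) u2 u3 u4 + T u1 (E u2) u3 u4
       + T u1 u2 (E u3) u4 + T u1 u2 u3 (E u4)).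

(* B . T and Q(A, T) for (0,4)-tensors T; the last two arguments are the
   ones after the semicolon in (B . T)(X1, X2, X3, X4; X, Y). *)
Definition dotT (B : 'rV[R]_n -> 'rV[R]_n -> 'rV[R]_n -> 'rV[R]_n)
    (T : tensor4) u1 u2 u3 u4 u v : R :=
  endo_act (B u v) T u1 u2 u3 u4.

Definition QT (A : 'rV[R]_n -> 'rV[R]_n -> R)
    (T : tensor4) u1 u2 u3 u4 u v : R :=
  endo_act (wedge_op A u v) T u1 u2 u3 u4.

Definition einstein_at g x : Prop :=
  forall u v, ricci g x u v = scalar_curv g x / n%:R * inner g x u v.

End Curvature.

Definition einstein (R : realType) (m : nat) (N : semiRiemannian R m) : Prop :=
  forall (c : chart R N m) (p : N), atlas c -> chart_dom c p ->
    einstein_at (metric c) (chart_coord c p).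

(** * Warped products

   The product manifold is described in its product charts [(c, d)]. *)

Section Warped.
Context (R : realType) (q m : nat).
Context (M : semiRiemannian R q) (N : semiRiemannian R m) (F : M -> R).
Implicit Types (c : chart R M q) (d : chart R N m) (z : M * N).

Definition prod_coord c d z : 'rV[R]_(q + m) :=
  row_mx (chart_coord c z.1) (chart_coord d z.2).

Definition warped_metric c d (w : 'rV[R]_(q + m)) : 'M[R]_(q + m) :=
  block_mx (metric c (lsubmx w)) 0
           0 (F (chart_param c (lsubmx w)) *: metric d (rsubmx w)).

Definition prod_dom c d : set (M * N) := chart_dom c `*` chart_dom d.

(* The parts of the sets U = {Q(S,R) <> 0}, U_S and U_C lying in the domain of
   the product chart [(c, d)].  Whether a tensor vanishes at a point does not
   depend on the chart in which it is evaluated. *)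
Definition U_QSR c d : set (M * N) :=
  [set z | prod_dom c d z /\
     let g := warped_metric c d in let x := prod_coord c d z in
     exists u1 u2 u3 u4 u v,
       QT (ricci g x) (R4 g x) u1 u2 u3 u4 u v != 0].

Definition U_S c d : set (M * N) :=
  [set z | prod_dom c d z /\
     ~ einstein_at (warped_metric c d) (prod_coord c d z)].

Definition U_C c d : set (M * N) :=
  [set z | prod_dom c d z /\
     let g := warped_metric c d in let x := prod_coord c d z in
     exists u1 u2 u3 u4, C4 g x u1 u2 u3 u4 != 0].

(* R . C - C . R = L Q(S, R) on U *)
Definition curvature_condition (L : M * N -> R) : Prop :=
  forall c d, atlas c -> atlas d -> forall z, U_QSR c d z ->
    let g := warped_metric c d in let x := prod_coord c d z in
    forall u1 u2 u3 u4 u v,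
      dotT (curv g x) (C4 g x) u1 u2 u3 u4 u v
      - dotT (weyl_op g x) (R4 g x) u1 u2 u3 u4 u v
      = L z * QT (ricci g x) (R4 g x) u1 u2 u3 u4 u v.

End Warped.

(* The coordinate x^1 of [c] satisfies g_11 = eps. *)
Definition unit_coord (R : realType) (M : semiRiemannian R 1) (eps : R)
    (c : chart R M 1) : Prop :=
  forall p, chart_dom c p -> metric c (chart_coord c p) 0 0 = eps.

(** * Components of tensors of the fiber *)

Section Components.
Context (R : realType) (m : nat) (g : 'rV[R]_m -> 'M[R]_m) (y : 'rV[R]_m).

Definition g_comp (i j : 'I_m) : R := g y i j.
Definition S_comp (i j : 'I_m) : R :=
  ricci g y (delta_mx 0 i) (delta_mx 0 j).
(* S_i^e = g^{ek} S_{ik} *)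
Definition S_mixed (i e : 'I_m) : R := \sum_k invmx (g y) e k * S_comp i k.
Definition R_comp (i j k l : 'I_m) : R :=
  R4 g y (delta_mx 0 i) (delta_mx 0 j) (delta_mx 0 k) (delta_mx 0 l).
Definition G_comp (i j k l : 'I_m) : R :=
  G4 g y (delta_mx 0 i) (delta_mx 0 j) (delta_mx 0 k) (delta_mx 0 l).

End Components.

(* Main.v *)
Require Import Defs.
From HB Require Import structures.
From mathcomp Require Import all_boot all_order all_algebra.
From mathcomp Require Import all_classical all_reals all_analysis.
From mathcomp Require Import ring lra.

(* Write F = phi^2 with phi > 0, v = phi'^2 and w = phi phi'', and let P be the trace-free
   part of the Ricci operator of the fiber.  The curvature of the warped product is
   determined by w and by the curvature R~ of the fiber shifted to Rh = R~ - eps v G~.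
   Where w <> 0 and P <> 0 the tensor Q(S,R) does not vanish, and the components of the
   condition with two base arguments give L = 1 / (n - 2) and
   (Rh + eps w G~)((P + eps w) X, Y, Z, T) = 0.  Contracting over Y and Z yields a quadratic
   equation for P.  As P is nonzero, trace-free and independent of the base point, its two
   coefficients are constant along the base; this makes w and v locally constant, and
   v = phi'^2 constant gives phi' phi'' = 0, hence phi' = 0, contradicting w <> 0.  The fiber
   is not Einstein, so P <> 0 somewhere on it; therefore phi'' = 0 and F = (a x + b)^2 on the
   whole connected chart.  With w = 0 the condition reduces to Rh(P X, Y, Z, T) = 0, which is
   the identity for the fiber, and to (1 - (n - 2) L) Q(S,R) = 0. *)

Set Implicit Arguments.
Unset Strict Implicit.
Unset Printing Implicit Defensive.

Import Order.TTheory GRing.Theory Num.Theory.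
Import numFieldNormedType.Exports.

Local Open Scope classical_set_scope.
Local Open Scope ring_scope.

(** * Partial derivatives *)

(** The condition is assumed only where Q(S,R) is nonzero, and nothing is known beforehand about
    that set. One fiber point with P nonzero is therefore fixed and only the base point moves. Over
    it Q(S,R) is nonzero wherever w is: with T the base vector, its component (T,Y,Z,T;U,V) equals w
    Q(g~,P), and Q(g~,P) contracts to a nonzero multiple of P. As w does not depend on the fiber,
    its vanishing over this single fiber point settles the whole base chart. L is found without any
    knowledge of R~. The component (T,Y,Z,T;U,V) of the condition and the symmetrization in V and Y
    of the component (T,Y,Z,X;T,V) have the same left side, and the symmetrization loses the terms
    in R~, which are skew in these two arguments. Splitting the Ricci operator of the fiber into P
    and a multiple of the identity makes the Weyl operator free of w and v. The function phi never
    appears: w and v are expressed by F, F' and F'', so no square root is differentiated. *)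

Section Partials.
Context (R : realType).

Lemma is_derive_line (V W : normedModType R) (f : V -> W) y v (s : R) :
  derivable f (s *: v + y) v ->
  is_derive s 1 (fun t : R => f (t *: v + y)) ('D_v f (s *: v + y)).
Proof.
rewrite /derivable => fd; have E : (fun h : R => h^-1 *:
    (((fun t : R => f (t *: v + y)) \o shift s) (h *: 1) - f (s *: v + y)))
  = (fun h => h^-1 *: ((f \o shift (s *: v + y)) (h *: v) - f (s *: v + y))).
  by apply/funext => h /=; rewrite scalerDl addrA [h *: 1]mulr1.
by apply: DeriveDef; rewrite /derivable /derive E.
Qed.

(** The bound [|s| <= |h|] treats both signs of [h] alike and is what the ball arguments below can
    supply. *)
Lemma MVT_line (V : normedModType R) (f : V -> R) y v (h : R) :
  (forall s, `|s| <= `|h| -> derivable f (s *: v + y) v) ->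
  exists2 s, `|s| <= `|h| & f (h *: v + y) - f y = h * 'D_v f (s *: v + y).
Proof.
move=> fd; pose phi (t : R) := f (t *: v + y).
pose dphi (t : R) := 'D_v f (t *: v + y).
have dP (s : R) : `|s| <= `|h| -> is_derive s 1 phi (dphi s).
  by move=> /fd; exact: is_derive_line.
have cP (a b : R) : (forall s, s \in `[a, b]%R -> `|s| <= `|h|) ->
    {within `[a, b], continuous phi}.
  move=> ab; apply: derivable_within_continuous => s /ab /dP.
  by move=> /@ex_derive.
have phi0 : phi 0 = f y by rewrite /phi scale0r add0r.
have [h0|h0|->] := ltgtP h 0; last first.
- by exists 0; rewrite ?normr0// scale0r add0r subrr mul0r.
- have ab s : s \in `[0, h]%R -> `|s| <= `|h|.
    by rewrite in_itv/= => /andP[s0 sh]; rewrite !ger0_norm// ltW.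
  have [|c cI e] := @MVT _ phi dphi 0 h h0 _ (cP _ _ ab).
    by move=> s sI; apply/dP/ab/subset_itv_oo_cc.
  by exists c; [apply/ab/subset_itv_oo_cc|rewrite -phi0 e subr0 mulrC].
- have ab s : s \in `[h, 0]%R -> `|s| <= `|h|.
    by rewrite in_itv/= => /andP[s0 sh]; rewrite !ler0_norm ?lerN2// ltW.
  have [|c cI e] := @MVT _ phi dphi h 0 h0 _ (cP _ _ ab).
    by move=> s sI; apply/dP/ab/subset_itv_oo_cc.
  exists c; first exact/ab/subset_itv_oo_cc.
  by apply: oppr_inj; rewrite -phi0 opprB e sub0r mulrN mulrC.
Qed.

Lemma differentiable_bigsum (V : normedModType R) k (f : 'I_k -> V -> R) x :
  (forall i, differentiable (f i) x) ->
  differentiable (fun y => \sum_(i < k) f i y) x.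
Proof.
move=> fd; have -> : (fun y => \sum_(i < k) f i y) = \sum_(i < k) f i.
  by apply/funext => y; rewrite fct_sumE.
exact: differentiable_sum.
Qed.

Lemma continuous_rV_linear m (df : {linear 'rV[R]_m -> R}) : continuous df.
Proof.
have -> : df = (fun v => \sum_i v 0 i * df (delta_mx 0 i)) :> ('rV[R]_m -> R).
  apply/funext => v; rewrite {1}(row_sum_delta v) linear_sum.
  by apply: eq_bigr => i _; rewrite linearZ.
move=> v; apply: differentiable_continuous; apply: differentiable_bigsum => i.
apply: (@differentiableM _ _ (fun v : 'rV[R]_m => v 0 i)); last exact: differentiable_cst.
exact: differentiable_coord.
Qed.

Lemma differentiable_linear_approx (V W : normedModType R) (f : V -> W)
    (df : {linear V -> W}) x :
  continuous df ->
  (forall e : R, 0 < e ->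
     \forall h \near 0, `|f (h + x) - f x - df h| <= e * `|h|) ->
  differentiable f x.
Proof.
move=> dfc dfP.
have H : f \o shift x = cst (f x) + df +o_ 0 id.
  apply/eqaddoP => e /dfP; apply: filterS => h.
  by rewrite -addrA -opprD.
by apply/diff_locallyP; rewrite (diff_unique dfc H).
Qed.

(** Smoothness in [Ck] concerns coordinate directions, whereas curvature differentiates along
    arbitrary vectors; this closes the gap. The increment is cut into legs parallel to the axes, and
    the mean value theorem is applied on each. *)
Lemma C1_differentiable m (f : 'rV[R]_m -> R) (x : 'rV[R]_m) :
  (forall i, \forall y \near x, derivable f y (delta_mx 0 i)) ->
  (forall i, {for x, continuous (fun y => 'D_(delta_mx 0 i) f y)}) ->
  differentiable f x.
Proof.
move=> fd fc.
pose dfun (v : 'rV[R]_m) := \sum_i v 0 i * 'D_(delta_mx 0 i) f x.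
have dlin : linear dfun.
  move=> a u v; rewrite /dfun scaler_sumr -big_split/=; apply: eq_bigr => i _.
  by rewrite !mxE mulrDl /GRing.scale/= mulrA.
pose dM := GRing.isLinear.Build _ _ _ _ _ dlin.
pose df : {linear 'rV[R]_m -> R} := HB.pack dfun dM.
have dfc : continuous df by exact: continuous_rV_linear.
apply: (differentiable_linear_approx dfc) => _/posnumP[e].
(* The share of each of the [m] legs; [m.+1] keeps it positive for [m = 0]. *)
have e'0 : 0 < e%:num / m.+1%:R by rewrite divr_gt0.
have Hnear : \forall y \near x, forall i, derivable f y (delta_mx 0 i) /\
    `|'D_(delta_mx 0 i) f x - 'D_(delta_mx 0 i) f y| <= e%:num / m.+1%:R.
  apply: (@filter_forall _ _ (fun i y => derivable f y (delta_mx 0 i) /\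
    `|'D_(delta_mx 0 i) f x - 'D_(delta_mx 0 i) f y| <= e%:num / m.+1%:R) (nbhs x) _) => i.
  apply: filterI; first exact: fd.
  by have /cvgrPdist_le := fc i; apply.
have [r /= r0 Hr] := (@nbhs_ballP _ _ _ _).1 Hnear.
near=> h.
(* [t k] keeps the first [k] coordinates of [h], so consecutive points differ along a single
   axis. *)
pose t (k : nat) : 'rV[R]_m := \row_j (if (j < k)%N then h 0 j else 0).
have tS (k : 'I_m) : t k.+1 = h 0 k *: delta_mx 0 k + t k.
  apply/rowP => j; rewrite !mxE eqxx ltnS leq_eqVlt val_eqE/=.
  by have [->|_] := eqVneq j k; rewrite ?ltnn ?mulr1 ?mulr0 ?addr0 ?add0r.
have t0 : t 0%N = 0 by apply/rowP => j; rewrite !mxE.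
have tm : t m = h by apply/rowP => j; rewrite !mxE ltn_ord.
have hr : `|h| < r by near: h; apply/nbhs_ballP;
  exists r => //= y; rewrite -ball_normE/= sub0r normrN.
have step (k : 'I_m) : `|f (t k.+1 + x) - f (t k + x)
     - h 0 k * 'D_(delta_mx 0 k) f x| <= e%:num / m.+1%:R * `|h|.
  have hk j : `|h 0 j| <= `|h|.
    rewrite [leRHS]/Num.Def.normr/= mx_normrE.
    exact: (le_bigmax _ (fun ij => `|h ij.1 ij.2|) (0, j)).
  have B (s : R) : `|s| <= `|h 0 k| ->
      ball x r (s *: delta_mx 0 k + (t k + x)).
    move=> sk; rewrite -ball_normE/= addrA opprD addrCA subrr addr0 normrN.
    apply: le_lt_trans hr; rewrite [leLHS]/Num.Def.normr/= mx_normrE.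
    apply: bigmax_le => // -[i j] _ /=; rewrite !ord1 !mxE eqxx/=.
    have [->|jk] := eqVneq j k.
      by rewrite ltnn mulr1 addr0 (le_trans sk).
    by rewrite mulr0 add0r; case: ifP => // _; rewrite normr0.
  have [s sk] : exists2 s : R, `|s| <= `|h 0 k| &
      f (h 0 k *: delta_mx 0 k + (t k + x)) - f (t k + x)
      = h 0 k * 'D_(delta_mx 0 k) f (s *: delta_mx 0 k + (t k + x)).
    by apply: MVT_line => s /B /Hr /(_ k) [].
  rewrite addrA -tS => ->; rewrite -mulrBr normrM mulrC.
  apply: ler_pM => //; have /Hr /(_ k) [_] := B _ sk.
  by rewrite distrC.
have -> : f (h + x) - f x - df h
   = \sum_(k < m) (f (t k.+1 + x) - f (t k + x) - h 0 k * 'D_(delta_mx 0 k) f x).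
  rewrite big_split/= sumrN.
  have -> : \sum_(k < m) (f (t k.+1 + x) - f (t k + x)) = f (h + x) - f x.
    rewrite -(big_mkord xpredT (fun k => f (t k.+1 + x) - f (t k + x))).
    by rewrite telescope_sumr// t0 add0r tm.
  by [].
apply: le_trans (ler_norm_sum _ _ _) _.
apply: (@le_trans _ _ (\sum_(k < m) e%:num / m.+1%:R * `|h|)).
  exact: ler_sum.
rewrite sumr_const card_ord -[_ *+ m]mulr_natl mulrA ler_wpM2r//.
by rewrite mulrCA ler_piMr// ler_pdivrMr ?ltr0n// mul1r ler_nat.
Unshelve. all: by end_near. Qed.

(** The mean value theorem is applied first in direction [u], to the difference of two translates of
    [f], and then in direction [v] to the derivative so obtained. *)
Lemma second_difference (V : normedModType R) (f : V -> R) x u v (h : R) :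
  (forall a b, `|a| <= `|h| -> `|b| <= `|h| ->
    derivable f (a *: v + (b *: u + x)) u /\
    derivable (fun y => 'D_u f y) (a *: v + (b *: u + x)) v) ->
  exists s s' : R, [/\ `|s| <= `|h|, `|s'| <= `|h| &
    f (h *: v + (h *: u + x)) - f (h *: v + x) - (f (h *: u + x) - f x)
    = h * (h * 'D_v (fun y => 'D_u f y) (s' *: v + (s *: u + x)))].
Proof.
move=> H; pose g y := f (h *: v + y) - f y.
have h0 : `|0 : R| <= `|h| by rewrite normr0.
have gd (s : R) : `|s| <= `|h| -> is_derive (s *: u + x) u g
    ('D_u f (h *: v + (s *: u + x)) - 'D_u f (s *: u + x)).
  move=> sh; have [d1 _] := H _ _ (lexx _) sh.
  have [d2 _] := H _ _ h0 sh; rewrite scale0r add0r in d2.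
  have E : (fun t : R => t^-1 *: (((fun y => f (h *: v + y)) \o shift (s *: u + x)) (t *: u)
        - f (h *: v + (s *: u + x))))
     = (fun t : R => t^-1 *: ((f \o shift (h *: v + (s *: u + x))) (t *: u)
        - f (h *: v + (s *: u + x)))).
    by apply/funext => t /=; rewrite [h *: v + (t *: u + _)]addrCA.
  apply: is_deriveB; last exact: derivableP.
  by apply: DeriveDef; rewrite /derivable /derive E.
have [s sh e1] := @MVT_line _ g x u h (fun s sh => @ex_derive _ _ _ _ _ _ _ (gd s sh)).
have /@derive_val eg := gd s sh; rewrite eg in e1.
have [|s' sh' e2] := @MVT_line _ (fun y => 'D_u f y) (s *: u + x) v h.
  by move=> s' s'h; have [_ d] := H _ _ s'h sh; exact: d.
by exists s, s'; split => //; rewrite -e2 -e1 /g; ring.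
Qed.

(** Schwarz's theorem. The second difference is symmetric in the two directions, so it equals
    [h ^+ 2] times either mixed derivative at points near [x], and continuity brings both within
    [e / 2] of their values at [x]. *)
Lemma derive_delta_comm m (f : 'rV[R]_m -> R) (x : 'rV[R]_m) (i j : 'I_m) :
  let di := delta_mx 0 i : 'rV[R]_m in let dj := delta_mx 0 j : 'rV[R]_m in
  (\forall y \near x, derivable f y di) ->
  (\forall y \near x, derivable f y dj) ->
  (\forall y \near x, derivable (fun z => 'D_di f z) y dj) ->
  (\forall y \near x, derivable (fun z => 'D_dj f z) y di) ->
  {for x, continuous (fun y => 'D_dj (fun z => 'D_di f z) y)} ->
  {for x, continuous (fun y => 'D_di (fun z => 'D_dj f z) y)} ->
  'D_dj (fun z => 'D_di f z) x = 'D_di (fun z => 'D_dj f z) x.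
Proof.
move=> di dj di_ dj_ fi fj cij cji.
apply/eqP; rewrite -subr_eq0 -normr_le0; apply/ler_addgt0Pl => e e0.
rewrite addr0.
have Hnear : \forall y \near x, [/\ derivable f y di, derivable f y dj,
    derivable (fun z => 'D_di f z) y dj, derivable (fun z => 'D_dj f z) y di &
    `|'D_dj (fun z => 'D_di f z) x - 'D_dj (fun z => 'D_di f z) y| <= e / 2 /\
    `|'D_di (fun z => 'D_dj f z) x - 'D_di (fun z => 'D_dj f z) y| <= e / 2].
  have e20 : 0 < e / 2 by rewrite divr_gt0.
  move/cvgrPdist_le : cij => /(_ _ e20) cij.
  move/cvgrPdist_le : cji => /(_ _ e20) cji.
  have FF := @nbhs_filter _ x.
  have H1 := @filterI _ _ FF _ _ (@filterI _ _ FF _ _ di_ dj_) (@filterI _ _ FF _ _ fi fj).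
  have H2 := @filterI _ _ FF _ _ H1 (@filterI _ _ FF _ _ cij cji).
  apply: (@filterS _ _ FF _ _ _ H2) => y [[[a b] [c d]] [k l]].
  exact: And5 a b c d (conj k l).
have [r /= r0 Hr] := (@nbhs_ballP _ _ _ _).1 Hnear.
(* The two displacements have norm at most [h] each, and [h + h < r]. *)
pose h := r / 3.
have h0 : 0 < h by rewrite divr_gt0.
have nd (k : 'I_m) : `|delta_mx 0 k : 'rV[R]_m| <= 1.
  rewrite [leLHS]/Num.Def.normr/= mx_normrE; apply: bigmax_le => // -[a b] _.
  by rewrite mxE; case: (_ && _); rewrite ?normr1 ?normr0.
have hh : `|h| = h by rewrite gtr0_norm.
have B (a b : R) : `|a| <= `|h| -> `|b| <= `|h| -> ball x r (a *: di + (b *: dj + x)).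
  rewrite hh => ah bh; rewrite -ball_normE/= addrA opprD addrCA subrr addr0 normrN.
  apply: le_lt_trans (ler_normD _ _) _; rewrite !normrZ.
  apply: (@le_lt_trans _ _ (h + h)); last first.
    by rewrite -mulr2n -mulr_natl /h; lra.
  by apply: lerD; rewrite -[leRHS]mulr1; apply: ler_pM => //; exact: nd.
have B' (a b : R) : `|a| <= `|h| -> `|b| <= `|h| -> ball x r (a *: dj + (b *: di + x)).
  by move=> ah bh; rewrite addrCA; apply: B.
have [s [s' [sh sh' e1]]] := @second_difference _ f x di dj h
  (fun a b ah bh => let: And5 p _ q _ _ := Hr _ (B' a b ah bh) in conj p q).
have [u [u' [uh uh' e2]]] := @second_difference _ f x dj di h
  (fun a b ah bh => let: And5 _ p _ q _ := Hr _ (B a b ah bh) in conj p q).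
have hn0 : h != 0 by rewrite gt_eqF.
have [_ _ _ _ [k1 _]] := Hr _ (B' s' s sh' sh).
have [_ _ _ _ [_ k2]] := Hr _ (B u' u uh' uh).
move: e1 e2 k1 k2; rewrite [h *: dj + (h *: di + x)]addrCA.
set b1 := 'D_dj _ (s' *: _ + _); set b2 := 'D_di _ (u' *: _ + _).
set a := 'D_dj _ x; set c := 'D_di _ x => e1 e2 k1 k2.
have e3 : b1 = b2.
  apply: (mulfI hn0); apply: (mulfI hn0); apply: etrans (esym e1) _.
  apply: etrans e2; ring.
rewrite -e3 in k2; clearbody a c b1 b2.
have -> : a - c = (a - b1) - (c - b1) by ring.
apply: le_trans (ler_normB _ _) _; rewrite (splitr e); exact: lerD k1 k2.
Qed.

End Partials.

(** * Directional derivatives of sums, products and inverse matrices *)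

Section DirectionalCalculus.
Context (R : realType).

Lemma derivable_bigsum (V : normedModType R) (I : Type) (r : seq I)
    (f : I -> V -> R) x v :
  (forall i, derivable (f i) x v) ->
  derivable (fun y => \sum_(i <- r) f i y) x v.
Proof.
move=> fd; elim: r => [|i r IH].
  rewrite [X in derivable X](_ : _ = cst 0); first exact: derivable_cst.
  by apply/funext => y; rewrite big_nil.
rewrite [X in derivable X](_ : _ = f i + (fun y => \sum_(i <- r) f i y)).
  exact: derivableD.
by apply/funext => y; rewrite big_cons.
Qed.

Lemma derive_bigsum (V : normedModType R) (I : Type) (r : seq I)
    (f : I -> V -> R) x v :
  (forall i, derivable (f i) x v) ->
  'D_v (fun y => \sum_(i <- r) f i y) x = \sum_(i <- r) 'D_v (f i) x.
Proof.
move=> fd; elim: r => [|i r IH].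
  rewrite big_nil [X in derive X](_ : _ = cst 0) ?derive_cst//.
  by apply/funext => y; rewrite big_nil.
rewrite big_cons [X in derive X](_ : _ = f i + (fun y => \sum_(i <- r) f i y)).
  by rewrite deriveD ?IH//; exact: derivable_bigsum.
by apply/funext => y; rewrite big_cons.
Qed.

Lemma derivable_bigprod (V : normedModType R) (I : Type) (r : seq I)
    (f : I -> V -> R) x v :
  (forall i, derivable (f i) x v) ->
  derivable (fun y => \prod_(i <- r) f i y) x v.
Proof.
move=> fd; elim: r => [|i r IH].
  rewrite [X in derivable X](_ : _ = cst 1); first exact: derivable_cst.
  by apply/funext => y; rewrite big_nil.
rewrite [X in derivable X](_ : _ = f i * (fun y => \prod_(i <- r) f i y)).
  exact: derivableM.
by apply/funext => y; rewrite big_cons.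
Qed.

Lemma derivable_cmul (V : normedModType R) (c : R) (f : V -> R) x v :
  derivable f x v -> derivable (fun y => c * f y) x v.
Proof. exact: derivableZ. Qed.

Lemma derive_cmul (V : normedModType R) (c : R) (f : V -> R) x v :
  derivable f x v -> 'D_v (fun y => c * f y) x = c * 'D_v f x.
Proof. exact: deriveZ. Qed.

Lemma derivable_mulfun (V : normedModType R) (f h : V -> R) x v :
  derivable f x v -> derivable h x v -> derivable (fun y => f y * h y) x v.
Proof. exact: derivableM. Qed.

Lemma derive_mulfun (V : normedModType R) (f h : V -> R) x v :
  derivable f x v -> derivable h x v ->
  'D_v (fun y => f y * h y) x = f x * 'D_v h x + h x * 'D_v f x.
Proof. exact: deriveM. Qed.

Lemma derivable_det (V : normedModType R) n (A : V -> 'M[R]_n) x v :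
  (forall i j, derivable (fun y => A y i j) x v) ->
  derivable (fun y => \det (A y)) x v.
Proof.
move=> Ad; apply: derivable_bigsum => s; apply: derivable_cmul.
exact: derivable_bigprod.
Qed.

(** Near [x] the inverse is the adjugate divided by the determinant. Invertibility around [x] enters
    because [invmx] returns its argument on a singular matrix. *)
Lemma derivable_invmx (V : normedModType R) n (A : V -> 'M[R]_n) x v :
  (\forall y \near x, A y \in unitmx) ->
  (forall i j, derivable (fun y => A y i j) x v) ->
  forall i j, derivable (fun y => invmx (A y) i j) x v.
Proof.
move=> Au Ad i j.
have Ax : A x \in unitmx by exact: (nbhs_singleton Au).
apply: (@near_eq_derivable _ _ _
  (fun y => (\det (A y))^-1 * cofactor (A y) j i)).
  by move: Au; apply: filterS => y Ay; rewrite /invmx Ay !mxE.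
apply: derivable_mulfun.
  apply: (@derivableV _ _ (fun y => \det (A y))); last exact: derivable_det.
  by move: Ax; rewrite unitmxE unitfE.
apply: derivable_cmul; apply: derivable_det => k l.
rewrite (_ : (fun _ => _) = (fun y => A y (lift j k) (lift i l))) //.
by apply/funext => y; rewrite !mxE.
Qed.

Lemma derive_sum_delta m (f : 'rV[R]_m -> R) x v :
  differentiable f x -> 'D_v f x = \sum_i v 0 i * 'D_(delta_mx 0 i) f x.
Proof.
move=> fd; rewrite deriveE// {1}(row_sum_delta v) linear_sum/=.
by apply: eq_bigr => i _; rewrite linearZ deriveE.
Qed.

End DirectionalCalculus.

(** * The metric as a bilinear form, and its derivatives *)

Section Inner.
Context (R : realType) (n : nat) (g : 'rV[R]_n -> 'M[R]_n).
Implicit Types (x u v w z : 'rV[R]_n) (a : R).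

Lemma innerE x u v : inner g x u v = \sum_i \sum_j u 0 i * g x i j * v 0 j.
Proof.
rewrite /inner mxE exchange_big/=; apply: eq_bigr => j _.
by rewrite !mxE mulr_suml.
Qed.

Lemma innerDl x u v w : inner g x (u + v) w = inner g x u w + inner g x v w.
Proof. by rewrite /inner !mulmxDl mxE. Qed.

Lemma innerDr x u v w : inner g x w (u + v) = inner g x w u + inner g x w v.
Proof. by rewrite /inner linearD/= mulmxDr mxE. Qed.

Lemma innerZl x a u w : inner g x (a *: u) w = a * inner g x u w.
Proof. by rewrite /inner -!scalemxAl mxE. Qed.

Lemma innerZr x a u w : inner g x w (a *: u) = a * inner g x w u.
Proof. by rewrite /inner linearZ/= -scalemxAr mxE. Qed.

Lemma innerNl x u w : inner g x (- u) w = - inner g x u w.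
Proof. by rewrite -scaleN1r innerZl mulN1r. Qed.

Lemma innerNr x u w : inner g x w (- u) = - inner g x w u.
Proof. by rewrite -scaleN1r innerZr mulN1r. Qed.

Lemma innerBl x u v w : inner g x (u - v) w = inner g x u w - inner g x v w.
Proof. by rewrite innerDl innerNl. Qed.

Lemma innerC x u v : (g x)^T = g x -> inner g x u v = inner g x v u.
Proof.
move=> gT; rewrite /inner -[LHS]/((u *m g x *m v^T) 0 0).
by rewrite -[u *m _ *m _]trmxK mxE !trmx_mul trmxK gT mulmxA.
Qed.

(** Vector identities are reduced to scalar ones by pairing with an arbitrary vector, which also
    removes the inverse metric from the Christoffel symbols. *)
Lemma inner_inj x u v : g x \in unitmx ->
  (forall w, inner g x u w = inner g x v w) -> u = v.
Proof.
move=> gU uv; apply: (can_inj (mulmxK gU)); apply/rowP => j.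
by have := uv (delta_mx 0 j); rewrite /inner trmx_delta -!colE !mxE.
Qed.

(** The derivative of the metric with [w] and [z] held constant. It stands in for the partial
    derivatives of the entries, so that the Koszul formula and the curvature can be written without
    indices. *)
Definition dinner v w z x : R := 'D_v (fun y => inner g y w z) x.

Lemma derivable_inner v w z x :
  (forall i j, derivable (fun y => g y i j) x v) ->
  derivable (fun y => inner g y w z) x v.
Proof.
move=> gd; under eq_fun do rewrite innerE.
apply: derivable_bigsum => i; apply: derivable_bigsum => j.
under eq_fun do rewrite mulrAC.
exact: derivable_cmul.
Qed.

Lemma dinner_entries v w z x :
  (forall i j, derivable (fun y => g y i j) x v) ->
  dinner v w z x = \sum_i \sum_j w 0 i * z 0 j * 'D_v (fun y => g y i j) x.
Proof.
move=> gd; rewrite /dinner; under eq_fun do rewrite innerE.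
rewrite derive_bigsum => [|i].
  apply: eq_bigr => i _; rewrite derive_bigsum => [|j].
    apply: eq_bigr => j _; under eq_fun do rewrite mulrAC.
    exact: derive_cmul.
  by under eq_fun do rewrite mulrAC; exact: derivable_cmul.
apply: derivable_bigsum => j.
by under eq_fun do rewrite mulrAC; exact: derivable_cmul.
Qed.

Lemma dinnerE v w z x :
  (forall i j, differentiable (fun y => g y i j) x) ->
  dinner v w z x = \sum_k \sum_i \sum_j
    v 0 k * w 0 i * z 0 j * 'D_(delta_mx 0 k) (fun y => g y i j) x.
Proof.
move=> gd; rewrite dinner_entries => [|i j]; last exact: diff_derivable.
rewrite [RHS]exchange_big/=; apply: eq_bigr => i _.
rewrite [RHS]exchange_big/=; apply: eq_bigr => j _.
by rewrite derive_sum_delta// mulr_sumr; apply: eq_bigr => k _; ring.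
Qed.

End Inner.

(** * Christoffel symbols and the curvature tensor *)

(* [ring] and [field] compare atoms up to conversion, which does not terminate in
   practice on derivatives. *)
Ltac generalize_atoms :=
  repeat match goal with
  | |- context [derive ?f ?x ?v] => generalize (derive f x v)
  | |- context [dinner ?g ?u ?v ?w ?x] => generalize (dinner g u v w x)
  | |- context [inner ?g ?x ?u ?v] => generalize (inner g x u v)
  end.

Section Christoffel.
Context (R : realType) (n : nat) (g : 'rV[R]_n -> 'M[R]_n).
Implicit Types (x y u v w z : 'rV[R]_n).

(** The covariant derivative of one field with constant components along another. *)
Definition chr y v w : 'rV[R]_n :=
  \row_k \sum_i \sum_j christoffel g y k i j * v 0 i * w 0 j.

Definition nondeg_diff y : Prop :=
  [/\ forall i j, differentiable (fun z => g z i j) y, (g y)^T = g y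
    & g y \in unitmx].

(** The Koszul formula, whose bracket terms vanish for constant components. [chr] is the covector
    [A] raised by the inverse metric, so pairing with [z] cancels the metric against its inverse. *)
Lemma inner_chr y v w z : nondeg_diff y ->
  inner g y (chr y v w) z
  = 2^-1 * (dinner g v w z y + dinner g w v z y - dinner g z v w y).
Proof.
move=> [gd gT gU].
pose D i j k := 'D_(delta_mx 0 i) (fun y => g y j k) y.
pose A : 'rV[R]_n := \row_m (2^-1 * \sum_i \sum_j v 0 i * w 0 j *
   (D i j m + D j i m - D m i j)).
have -> : chr y v w = A *m (invmx (g y))^T.
  apply/rowP => k; rewrite !mxE.
  transitivity (\sum_i \sum_j \sum_l 2^-1 * (invmx (g y) k l * (D i j l + D j i l - D l i j)
     * (v 0 i * w 0 j))).
    apply: eq_bigr => i _; apply: eq_bigr => j _.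
    rewrite /christoffel -mulrA -mulrA mulr_suml mulr_sumr.
    by apply: eq_bigr.
  rewrite [RHS](_ : _ = \sum_l \sum_i \sum_j 2^-1 * (invmx (g y) k l *
     (D i j l + D j i l - D l i j) * (v 0 i * w 0 j))); last first.
    apply: eq_bigr => l _; rewrite !mxE mulr_sumr mulr_suml; apply: eq_bigr => i _.
    by rewrite mulr_sumr mulr_suml; apply: eq_bigr => j _; ring.
  rewrite [RHS]exchange_big/=; apply: eq_bigr => i _.
  by rewrite [RHS]exchange_big.
rewrite /inner -(mulmxA A) -{2}gT -trmx_mul mulmxV// trmx1 mulmx1 !dinnerE// mxE.
transitivity (\sum_i \sum_j \sum_m 2^-1 * (v 0 i * w 0 j * z 0 m *
   (D i j m + D j i m - D m i j))).
  transitivity (\sum_m \sum_i \sum_j 2^-1 * (v 0 i * w 0 j * z 0 m *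
   (D i j m + D j i m - D m i j))).
    apply: eq_bigr => m _; rewrite !mxE mulr_sumr mulr_suml; apply: eq_bigr => i _.
    by rewrite mulr_sumr mulr_suml; apply: eq_bigr => j _; ring.
  by rewrite exchange_big/=; apply: eq_bigr => i _; rewrite exchange_big.
rewrite [X in _ * (_ + X - _)]exchange_big/=.
rewrite [X in _ * (_ - X)]exchange_big/=.
under [X in _ * (_ - X)]eq_bigr do rewrite exchange_big/=.
rewrite -big_split/= -sumrB mulr_sumr; apply: eq_bigr => i _.
rewrite -big_split/= -sumrB mulr_sumr; apply: eq_bigr => j _.
rewrite -big_split/= -sumrB mulr_sumr; apply: eq_bigr => k _.
by rewrite /D; ring.
Qed.

Lemma nabla_cst v w : nabla g (fun=> v) (fun=> w) = fun y => chr y v w.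
Proof. by apply/funext => y; apply/rowP => k; rewrite !mxE derive_cst add0r. Qed.

Lemma curv_chr x u v w :
  curv g x u v w = (\row_k 'D_u (fun y => chr y v w 0 k) x + chr x u (chr x v w))
    - (\row_k 'D_v (fun y => chr y u w 0 k) x + chr x v (chr x u w)).
Proof.
rewrite /curv /curv_field !nabla_cst.
have -> : nabla g (lie_bracket (fun=> u) (fun=> v)) (fun=> w) x = 0.
  have L0 : lie_bracket (fun=> u) (fun=> v) x = 0.
    by apply/rowP => k; rewrite !mxE !derive_cst subrr.
  apply/rowP => k; rewrite !mxE L0 derive0 add0r big1// => i _.
  by rewrite big1// => j _; rewrite mxE mulr0 mul0r.
by rewrite subr0; congr (_ - _); apply/rowP => k; rewrite !mxE.
Qed.

Lemma derivable_chr x u v w k :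
  (\forall y \near x, g y \in unitmx) ->
  (forall i j, derivable (fun y => g y i j) x u) ->
  (forall i j k, derivable (fun y => 'D_(delta_mx 0 k) (fun z => g z i j) y) x u) ->
  derivable (fun y => chr y v w 0 k) x u.
Proof.
move=> gU gd gdd; under eq_fun do rewrite mxE.
apply: derivable_bigsum => i; apply: derivable_bigsum => j.
rewrite (_ : (fun _ => _) = (fun y => (v 0 i * w 0 j) * christoffel g y k i j)); last first.
  by apply/funext => y; ring.
apply: derivable_cmul; apply: derivable_cmul; apply: derivable_bigsum => l.
apply: derivable_mulfun; first exact: derivable_invmx.
apply: derivableB; last exact: gdd.
by apply: derivableD; exact: gdd.
Qed.

Section R4_formula.
Context (x : 'rV[R]_n) (gx : \forall y \near x, nondeg_diff y)
  (gdd : forall i j k u,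
     derivable (fun y => 'D_(delta_mx 0 k) (fun z => g z i j) y) x u).

Let gx0 : nondeg_diff x. Proof. exact: nbhs_singleton gx. Qed.

Let gd i j u : derivable (fun y => g y i j) x u.
Proof. by case: gx0 => gd _ _; exact: diff_derivable. Qed.

Lemma dinnerC v w z : dinner g v w z x = dinner g v z w x.
Proof.
apply: near_eq_derive; move: gx; apply: filterS => y [_ ? _].
exact: innerC.
Qed.

Let near_dinner v w z : \forall y \near x, \sum_k \sum_i \sum_j
    v 0 k * w 0 i * z 0 j * 'D_(delta_mx 0 k) (fun y => g y i j) y
  = dinner g v w z y.
Proof. by move: gx; apply: filterS => y [? _ _]; rewrite dinnerE. Qed.

Lemma derivable_dinner u v w z : derivable (dinner g v w z) x u.
Proof.
apply: (near_eq_derivable (near_dinner v w z)).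
apply: derivable_bigsum => k; apply: derivable_bigsum => i.
apply: derivable_bigsum => j; apply: derivable_cmul; exact: gdd.
Qed.

Lemma derive_dinner u v w z : 'D_u (dinner g v w z) x = \sum_k \sum_i \sum_j
    v 0 k * w 0 i * z 0 j * 'D_u (fun y => 'D_(delta_mx 0 k) (fun y => g y i j) y) x.
Proof.
rewrite -(near_eq_derive _ (near_dinner v w z)).
have d3 k i j : derivable (fun y => v 0 k * w 0 i * z 0 j *
    'D_(delta_mx 0 k) (fun y => g y i j) y) x u.
  by apply: derivable_cmul; exact: gdd.
rewrite derive_bigsum => [|k].
  apply: eq_bigr => k _; rewrite derive_bigsum => [|i].
    apply: eq_bigr => i _; rewrite derive_bigsum => [|j].
      by apply: eq_bigr => j _; rewrite derive_cmul//; exact: gdd.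
    exact: d3.
  by apply: derivable_bigsum.
by apply: derivable_bigsum => i; apply: derivable_bigsum.
Qed.

Let derive_row u (c : 'rV[R]_n -> 'rV[R]_n) z :
  (forall k, derivable (fun y => c y 0 k) x u) ->
  inner g x (\row_k 'D_u (fun y => c y 0 k) x) z
  = 'D_u (fun y => inner g y (c y) z) x - dinner g u (c x) z x.
Proof.
move=> cd.
have d1 k j : derivable (fun y => c y 0 k * g y k j) x u by exact: derivable_mulfun.
have d2 k j : derivable (fun y => c y 0 k * g y k j * z 0 j) x u.
  by apply: derivable_mulfun => //; exact: derivable_cst.
rewrite dinner_entries// innerE.
have -> : (fun y => inner g y (c y) z)
   = (fun y => \sum_k \sum_j c y 0 k * g y k j * z 0 j).
  by apply/funext => y; rewrite innerE.
rewrite derive_bigsum => [|k]; last by apply: derivable_bigsum.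
rewrite -sumrB; apply: eq_bigr => k _.
rewrite derive_bigsum => [|j]; last exact: d2.
rewrite -sumrB; apply: eq_bigr => j _.
have -> : 'D_u (fun y => c y 0 k * g y k j * z 0 j) x
   = z 0 j * (c x 0 k * 'D_u (fun y => g y k j) x + g x k j * 'D_u (fun y => c y 0 k) x).
  apply: etrans (derive_mulfun (d1 k j) (derivable_cst (z 0 j) x u)) _.
  by rewrite derive_cst mulr0 add0r derive_mulfun.
by rewrite mxE; ring.
Qed.

(** Lowering the last index turns derivatives of Christoffel symbols into second derivatives of the
    metric. The last two of these cancel by Schwarz's theorem; they are kept so that the formula
    also serves the warped metric, for which only differentiability of the first derivatives is
    established below. *)
Lemma R4E u v w z :
  R4 g x u v w z = 2^-1 *
    ('D_u (dinner g w v z) x - 'D_u (dinner g z v w) x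
     - 'D_v (dinner g w u z) x + 'D_v (dinner g z u w) x
     + 'D_u (dinner g v w z) x - 'D_v (dinner g u w z) x)
  + inner g x (chr x u w) (chr x v z) - inner g x (chr x v w) (chr x u z).
Proof.
have gU : \forall y \near x, g y \in unitmx.
  by move: gx; apply: filterS => y [].
have gT : (g x)^T = g x by case: gx0.
(* Metric compatibility: for [C = chr g x b c], the Koszul formula splits [dinner g a C z x] into
   the pairing of [chr g x a C] with [z], which cancels, and that of [C] with [chr g x a z]. *)
have dchr a b c : inner g x (\row_k 'D_a (fun y => chr y b c 0 k) x + chr x a (chr x b c)) z
   = 2^-1 * ('D_a (dinner g b c z) x + 'D_a (dinner g c b z) x - 'D_a (dinner g z b c) x)
     - inner g x (chr x b c) (chr x a z).
  rewrite innerDl derive_row => [|k]; last exact: derivable_chr.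
  rewrite (@near_eq_derive _ _ _ _ (fun y => 2^-1 *
     (dinner g b c z y + dinner g c b z y - dinner g z b c y))); last first.
    by move: gx; apply: filterS => y /inner_chr.
  have dd b' c' z' : derivable (dinner g b' c' z') x a by exact: derivable_dinner.
  rewrite derive_cmul; last by apply: derivableB => //; exact: derivableD.
  rewrite (@deriveB _ _ _ (dinner g b c z + dinner g c b z) (dinner g z b c))//;
    last exact: derivableD.
  rewrite deriveD// [inner g x (chr x b c) _]innerC// !inner_chr//.
  rewrite (dinnerC _ z).
  generalize_atoms; move=> *; by field.
rewrite /R4 curv_chr innerBl !dchr; generalize_atoms; move=> *; by field.
Qed.

End R4_formula.

End Christoffel.

(** * Symmetries of the curvature tensor *)

Section SmoothFunctions.
Context (R : realType) (m : nat) (O : set 'rV[R]_m) (oO : open O).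
Implicit Types (f : 'rV[R]_m -> R) (x : 'rV[R]_m).

Lemma smooth_on_derive f i : smooth_on O f ->
  smooth_on O (fun x => 'D_(delta_mx 0 i) f x).
Proof. by move=> fs k; have [_ /(_ i) []] := fs k.+1. Qed.

Lemma smooth_on_continuous f x : smooth_on O f -> O x -> {for x, continuous f}.
Proof. by move=> /(_ 0%N) [+ _] Ox; apply; rewrite inE. Qed.

Lemma smooth_on_derivable f i x : smooth_on O f -> O x ->
  derivable f x (delta_mx 0 i).
Proof. by move=> /(_ 1%N) [_ /(_ i) [+ _]] Ox; apply; rewrite inE. Qed.

Lemma near_open (P : 'rV[R]_m -> Prop) x : O x -> (forall y, O y -> P y) ->
  \forall y \near x, P y.
Proof. by move=> Ox OP; move: (open_nbhs_nbhs (conj oO Ox)); apply: filterS. Qed.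

Lemma smooth_on_differentiable f x : smooth_on O f -> O x -> differentiable f x.
Proof.
move=> fs Ox; apply: C1_differentiable => i.
  by apply: near_open => // y; exact: smooth_on_derivable.
exact: smooth_on_continuous (smooth_on_derive i fs) Ox.
Qed.

Lemma smooth_on_derive_comm f i j x : smooth_on O f -> O x ->
  'D_(delta_mx 0 j) (fun z => 'D_(delta_mx 0 i) f z) x
  = 'D_(delta_mx 0 i) (fun z => 'D_(delta_mx 0 j) f z) x.
Proof.
move=> fs Ox; have fs1 k := smooth_on_derive k fs.
apply: derive_delta_comm.
- by apply: near_open => // y; exact: smooth_on_derivable fs.
- by apply: near_open => // y; exact: smooth_on_derivable fs.
- by apply: near_open => // y; exact: smooth_on_derivable (fs1 i).
- by apply: near_open => // y; exact: smooth_on_derivable (fs1 j).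
- exact: smooth_on_continuous (smooth_on_derive j (fs1 i)) Ox.
- exact: smooth_on_continuous (smooth_on_derive i (fs1 j)) Ox.
Qed.

End SmoothFunctions.

Definition smooth_metric (R : realType) (n : nat) (O : set 'rV[R]_n)
    (g : 'rV[R]_n -> 'M[R]_n) : Prop :=
  [/\ open O, forall i j, smooth_on O (fun y => g y i j),
      forall y, O y -> (g y)^T = g y & forall y, O y -> g y \in unitmx].

Section Symmetries.
Context (R : realType) (n : nat) (O : set 'rV[R]_n) (g : 'rV[R]_n -> 'M[R]_n)
  (gs : smooth_metric O g).
Implicit Types (x y u v w z : 'rV[R]_n).

Let oO : open O. Proof. by case: gs. Qed.

Lemma smooth_metric_nondeg x : O x -> nondeg_diff g x.
Proof.
case: gs => _ s gT gU Ox; split; [move=> i j|exact: gT|exact: gU].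
exact (smooth_on_differentiable oO (s i j) Ox).
Qed.

Lemma smooth_metric_near x : O x -> \forall y \near x, nondeg_diff g y.
Proof. by move=> Ox; apply: (near_open oO Ox) => y; exact: smooth_metric_nondeg. Qed.

Lemma smooth_metric_derivable2 x : O x -> forall i j k u,
  derivable (fun y => 'D_(delta_mx 0 k) (fun z => g z i j) y) x u.
Proof.
case: gs => _ s _ _ Ox i j k u; apply: diff_derivable.
exact (smooth_on_differentiable oO (smooth_on_derive k (s i j)) Ox).
Qed.

(** Schwarz's theorem for the coordinate directions, carried to arbitrary ones by expanding both
    derivatives. *)
Lemma derive_dinner_comm x u v w z : O x ->
  'D_u (dinner g v w z) x = 'D_v (dinner g u w z) x.
Proof.
case: gs => _ s _ _ Ox.
have E u' v' : 'D_u' (dinner g v' w z) x = \sum_k \sum_l \sum_i \sum_j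
    u' 0 l * v' 0 k * w 0 i * z 0 j *
    'D_(delta_mx 0 l) (fun y => 'D_(delta_mx 0 k) (fun y => g y i j) y) x.
  rewrite (derive_dinner (smooth_metric_near Ox) (smooth_metric_derivable2 Ox)).
  apply: eq_bigr => k _; rewrite [RHS]exchange_big/=; apply: eq_bigr => i _.
  rewrite [RHS]exchange_big/=; apply: eq_bigr => j _.
  rewrite (derive_sum_delta _ (smooth_on_differentiable oO (smooth_on_derive k (s i j)) Ox)).
  rewrite mulr_sumr; apply: eq_bigr => l _; generalize_atoms => *; ring.
rewrite !E [LHS]exchange_big/=; apply: eq_bigr => k _; apply: eq_bigr => l _.
apply: eq_bigr => i _; apply: eq_bigr => j _.
by rewrite (smooth_on_derive_comm oO l k (s i j) Ox) [u 0 k * _]mulrC.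
Qed.

Lemma derive_dinnerC x u v w z : O x ->
  'D_u (dinner g v w z) x = 'D_u (dinner g v z w) x.
Proof.
move=> Ox; apply: near_eq_derive; apply: (near_open oO Ox) => y Oy.
exact: (dinnerC (smooth_metric_near Oy)).
Qed.

Lemma chrC x u v : O x -> chr g x u v = chr g x v u.
Proof.
move=> Ox; have Nx := smooth_metric_nondeg Ox.
apply: (@inner_inj _ _ g x); first by case: Nx.
move=> w; rewrite !inner_chr// (dinnerC (smooth_metric_near Ox) w u).
by rewrite [dinner g u v w x + _]addrC.
Qed.

Lemma R4_smoothE x u v w z : O x ->
  R4 g x u v w z = 2^-1 *
    ('D_u (dinner g w v z) x - 'D_u (dinner g z v w) x
     - 'D_v (dinner g w u z) x + 'D_v (dinner g z u w) x)
  + inner g x (chr g x u w) (chr g x v z) - inner g x (chr g x v w) (chr g x u z).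
Proof.
move=> Ox; rewrite (R4E (smooth_metric_near Ox) (smooth_metric_derivable2 Ox)).
by rewrite (derive_dinner_comm u v w z Ox) addrK.
Qed.

Lemma R4_swap12 x u v w z : R4 g x u v w z = - R4 g x v u w z.
Proof. by rewrite /R4 !curv_chr -innerNl opprB. Qed.

Lemma R4_swap34 x u v w z : O x -> R4 g x u v w z = - R4 g x u v z w.
Proof.
move=> Ox; rewrite !(R4_smoothE _ _ _ _ Ox); have [_ gT _] := smooth_metric_nondeg Ox.
rewrite [inner g x (chr g x v w) _](innerC _ _ gT).
rewrite [inner g x (chr g x u w) _](innerC _ _ gT).
generalize_atoms => *; ring.
Qed.

(** Read off from the coordinate formula: Schwarz's theorem and the symmetry of the metric match the
    four second derivatives, and [chrC] matches the products of Christoffel vectors. *)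
Lemma R4_pair x u v w z : O x -> R4 g x u v w z = R4 g x w z u v.
Proof.
move=> Ox; rewrite !(R4_smoothE _ _ _ _ Ox); have [_ gT _] := smooth_metric_nondeg Ox.
rewrite (chrC w u Ox) (chrC z v Ox) (chrC w v Ox) (chrC z u Ox).
rewrite [inner g x (chr g x u z) _](innerC _ _ gT).
rewrite (derive_dinner_comm w u _ _ Ox) (derive_dinner_comm w v _ _ Ox).
rewrite (derive_dinner_comm z u _ _ Ox) (derive_dinner_comm z v _ _ Ox).
rewrite (derive_dinnerC u w z v Ox) (derive_dinnerC v w z u Ox).
rewrite (derive_dinnerC u z w v Ox) (derive_dinnerC v z w u Ox).
generalize_atoms => *; ring.
Qed.

End Symmetries.

(** * Curvature of a warped product over a one-dimensional base *)

Section LinearComposition.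
Context (R : realType) (V V' : normedModType R) (W : normedModType R)
  (l : {linear V -> V'}) (F : V' -> W).

Let quotient v y :
  (fun k : R => k^-1 *: (((fun y => F (l y)) \o shift y) (k *: v) - F (l y)))
  = (fun k : R => k^-1 *: ((F \o shift (l y)) (k *: l v) - F (l y))).
Proof. by apply/funext => k /=; rewrite linearP. Qed.

(** By linearity of [l] the two difference quotients are the same function. The projections of the
    product onto its factors are of this kind. *)
Lemma derive_comp_linear v y : 'D_v (fun y => F (l y)) y = 'D_(l v) F (l y).
Proof. by rewrite /derive quotient. Qed.

Lemma derivable_comp_linear v y :
  derivable F (l y) (l v) -> derivable (fun y => F (l y)) y v.
Proof. by rewrite /derivable quotient. Qed.

End LinearComposition.

Local Opaque derive.

Lemma derive_addfun (R : realType) (V : normedModType R) (f h : V -> R) x v :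
  derivable f x v -> derivable h x v ->
  'D_v (fun y => f y + h y) x = 'D_v f x + 'D_v h x.
Proof. exact: deriveD. Qed.

Section WarpedCurvature.
Context (R : realType) (p : nat) (eps : R) (heps : eps = 1 \/ eps = -1).
Context (O1 : set 'rV[R]_1) (gb : 'rV[R]_1 -> 'M[R]_1)
  (gbs : smooth_metric O1 gb) (gbE : forall t, O1 t -> gb t 0 0 = eps).
Context (f : 'rV[R]_1 -> R) (fs : smooth_on O1 f) (f_gt0 : forall t, O1 t -> 0 < f t).
Context (O2 : set 'rV[R]_p) (h : 'rV[R]_p -> 'M[R]_p) (hs : smooth_metric O2 h).
Implicit Types (t : 'rV[R]_1) (x y u v w z : 'rV[R]_(1 + p)).

Definition warp (y : 'rV[R]_(1 + p)) : 'M[R]_(1 + p) :=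
  block_mx (gb (lsubmx y)) 0 0 (f (lsubmx y) *: h (rsubmx y)).

Definition df t : R := 'D_(delta_mx 0 0) f t.
Definition ddf t : R := 'D_(delta_mx 0 0) df t.

Local Notation lc v := (lsubmx v 0 0).
Local Notation rc v := (rsubmx v).

Let dom y : Prop := O1 (lsubmx y) /\ O2 (rsubmx y).

Let oO1 : open O1. Proof. by case: gbs. Qed.
Let oO2 : open O2. Proof. by case: hs. Qed.

Let dom_near x (P : 'rV[R]_(1 + p) -> Prop) : dom x -> (forall y, dom y -> P y) ->
  \forall y \near x, P y.
Proof.
move=> [x1 x2] OP.
have n1 : \forall y \near x, O1 (lsubmx y).
  by apply: (@continuous_lsubmx R 1 1 p x); exact: open_nbhs_nbhs.
have n2 : \forall y \near x, O2 (rsubmx y).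
  by apply: (@continuous_rsubmx R 1 1 p x); exact: open_nbhs_nbhs.
by apply: filterS2 n1 n2 => y ? ?; exact: OP.
Qed.

Lemma inner_warp y u v : O1 (lsubmx y) ->
  inner warp y u v
  = eps * lc u * lc v + f (lsubmx y) * inner h (rsubmx y) (rc u) (rc v).
Proof.
move=> y1; have gE : gb (lsubmx y) = eps%:M.
  by apply/matrixP => i j; rewrite !ord1 gbE// mxE eqxx.
rewrite /inner /warp -{1}(hsubmxK u) -{1}(hsubmxK v) tr_row_mx mul_row_block.
rewrite mul_row_col !mulmx0 addr0 add0r gE mul_mx_scalar.
rewrite mxE -!scalemxAr -!scalemxAl !mxE; congr (_ + _).
by rewrite big_ord1 !mxE mulrA.
Qed.

Let derive_lsub (F : 'rV[R]_1 -> R) v y :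
  'D_v (fun y => F (lsubmx y)) y = 'D_(lsubmx v) F (lsubmx y).
Proof. exact: derive_comp_linear. Qed.

Let derive_rsub (F : 'rV[R]_p -> R) v y :
  'D_v (fun y => F (rsubmx y)) y = 'D_(rsubmx v) F (rsubmx y).
Proof. exact: derive_comp_linear. Qed.

Let derivable_lsub (F : 'rV[R]_1 -> R) v y : differentiable F (lsubmx y) ->
  derivable (fun y : 'rV[R]_(1 + p) => F (lsubmx y)) y v.
Proof.
move=> Fd; apply: diff_derivable.
apply (@differentiable_comp _ _ _ _ (lsubmx : 'rV[R]_(1 + p) -> 'rV[R]_1) F y) => //.
exact (@differentiable_lsubmx _ 1 1 p y).
Qed.

Let derivable_rsub (F : 'rV[R]_p -> R) v y :
  derivable F (rsubmx y) (rsubmx v) ->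
  derivable (fun y : 'rV[R]_(1 + p) => F (rsubmx y)) y v.
Proof.
exact: derivable_comp_linear. Qed.

Let smooth1 (F : 'rV[R]_1 -> R) t a : smooth_on O1 F -> O1 t ->
  'D_a F t = a 0 0 * 'D_(delta_mx 0 0) F t.
Proof.
move=> Fs t1; rewrite (derive_sum_delta _ (smooth_on_differentiable oO1 Fs t1)).
by rewrite big_ord1.
Qed.

Let dfs : smooth_on O1 df. Proof. exact: smooth_on_derive. Qed.

Let derivable_smooth1 (F : 'rV[R]_1 -> R) v y : smooth_on O1 F -> O1 (lsubmx y) ->
  derivable (fun y : 'rV[R]_(1 + p) => F (lsubmx y)) y v.
Proof.
move=> Fs y1; apply: derivable_lsub.
exact (smooth_on_differentiable oO1 Fs y1).
Qed.

Let derivable_h (w z : 'rV[R]_p) v y : O2 (rsubmx y) ->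
  derivable (fun y : 'rV[R]_(1 + p) => inner h (rsubmx y) w z) y v.
Proof.
move=> y2; apply: (@derivable_rsub (fun r => inner h r w z)).
apply: derivable_inner => i j; have [hd _ _] := smooth_metric_nondeg hs y2.
by apply: diff_derivable; exact (hd i j).
Qed.

Let derivable_dh (u w z : 'rV[R]_p) v y : O2 (rsubmx y) ->
  derivable (fun y : 'rV[R]_(1 + p) => dinner h u w z (rsubmx y)) y v.
Proof.
move=> y2; apply: (@derivable_rsub (dinner h u w z)).
exact: (derivable_dinner (smooth_metric_near hs y2) (smooth_metric_derivable2 hs y2)).
Qed.

(** The base block of the metric is the constant [eps] on [O1], so only [f] and [h] contribute. *)
Lemma dinner_warp v w z y : dom y ->
  dinner warp v w z y
  = lc v * df (lsubmx y) * inner h (rsubmx y) (rc w) (rc z)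
    + f (lsubmx y) * dinner h (rc v) (rc w) (rc z) (rsubmx y).
Proof.
move=> dy; have [y1 y2] := dy; rewrite {1}/dinner.
rewrite (@near_eq_derive _ _ _ _ (fun y => eps * lc w * lc z
   + f (lsubmx y) * inner h (rsubmx y) (rc w) (rc z))); last first.
  by apply: (dom_near dy) => y' [? _]; exact: inner_warp.
have d1 := @derivable_smooth1 f v y fs y1.
have d2 := @derivable_h (rc w) (rc z) v y y2.
rewrite (derive_addfun (derivable_cst _ _ _) (derivable_mulfun d1 d2)).
rewrite derive_cst add0r (derive_mulfun d1 d2) derive_lsub (smooth1 _ fs y1).
rewrite (@derive_rsub (fun r => inner h r (rc w) (rc z))) -/(dinner _ _ _ _ _).
by rewrite -/(df _); move: (df _) => F1; generalize_atoms => *; ring.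
Qed.

Lemma derivable_dinner_warp u v w z x : dom x -> derivable (dinner warp v w z) x u.
Proof.
move=> dx; have [x1 x2] := dx.
apply: (@near_eq_derivable _ _ _ (fun y => lc v * df (lsubmx y) * inner h (rsubmx y) (rc w) (rc z)
    + f (lsubmx y) * dinner h (rc v) (rc w) (rc z) (rsubmx y))).
  by apply: (dom_near dx) => y /dinner_warp ->.
apply: derivableD; apply: derivable_mulfun.
- by apply: derivable_cmul; exact: derivable_smooth1.
- exact: derivable_h.
- exact: derivable_smooth1.
- exact: derivable_dh.
Qed.

Lemma derive_dinner_warp u v w z x : dom x ->
  'D_u (dinner warp v w z) x
  = lc u * lc v * ddf (lsubmx x) * inner h (rsubmx x) (rc w) (rc z)
    + lc v * df (lsubmx x) * dinner h (rc u) (rc w) (rc z) (rsubmx x)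
    + lc u * df (lsubmx x) * dinner h (rc v) (rc w) (rc z) (rsubmx x)
    + f (lsubmx x) * 'D_(rc u) (dinner h (rc v) (rc w) (rc z)) (rsubmx x).
Proof.
move=> dx; have [x1 x2] := dx.
rewrite (@near_eq_derive _ _ _ _ (fun y => lc v * df (lsubmx y) * inner h (rsubmx y) (rc w) (rc z)
    + f (lsubmx y) * dinner h (rc v) (rc w) (rc z) (rsubmx y))); last first.
  by apply: (dom_near dx) => y' dy'; exact: dinner_warp.
have d1 := @derivable_smooth1 df u x dfs x1.
have d2 := @derivable_h (rc w) (rc z) u x x2.
have d3 := @derivable_smooth1 f u x fs x1.
have d4 := @derivable_dh (rc v) (rc w) (rc z) u x x2.
have d5 := @derivable_cmul _ _ (lc v) _ _ _ d1.
rewrite (derive_addfun (derivable_mulfun d5 d2) (derivable_mulfun d3 d4)).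
rewrite (derive_mulfun d5 d2) (derive_mulfun d3 d4) (derive_cmul _ d1).
rewrite !derive_lsub (smooth1 _ fs x1) (smooth1 _ dfs x1).
rewrite (@derive_rsub (fun r => inner h r (rc w) (rc z))) -/(dinner _ _ _ _ _).
rewrite derive_rsub -/(df _) -/(ddf _).
by move: (df _) (ddf _) => F1 F2; generalize_atoms => *; ring.
Qed.

Lemma nondeg_warp y : dom y -> nondeg_diff warp y.
Proof.
move=> [y1 y2]; have [hd hT hU] := smooth_metric_nondeg hs y2.
have [bd bT bU] := smooth_metric_nondeg gbs y1.
have dl (F : 'rV[R]_1 -> R) : differentiable F (lsubmx y) ->
    differentiable (fun y : 'rV[R]_(1 + p) => F (lsubmx y)) y.
  move=> Fd.
  apply (@differentiable_comp _ _ _ _ (lsubmx : 'rV[R]_(1 + p) -> 'rV[R]_1) F y) => //.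
  exact (@differentiable_lsubmx _ 1 1 p y).
have dr (F : 'rV[R]_p -> R) : differentiable F (rsubmx y) ->
    differentiable (fun y : 'rV[R]_(1 + p) => F (rsubmx y)) y.
  move=> Fd.
  apply (@differentiable_comp _ _ _ _ (rsubmx : 'rV[R]_(1 + p) -> 'rV[R]_p) F y) => //.
  exact (@differentiable_rsubmx _ 1 1 p y).
split.
- move=> i j; case: (split_ordP i) => i' ->; case: (split_ordP j) => j' ->.
  + rewrite (_ : (fun _ => _) = (fun y => gb (lsubmx y) i' j')).
      exact (dl (fun t => gb t i' j') (bd i' j')).
    by apply/funext => z; rewrite /warp block_mxEul.
  + rewrite (_ : (fun _ => _) = cst 0); first exact (differentiable_cst _ _).
    by apply/funext => z; rewrite /warp block_mxEur mxE.
  + rewrite (_ : (fun _ => _) = cst 0); first exact (differentiable_cst _ _).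
    by apply/funext => z; rewrite /warp block_mxEdl mxE.
  + rewrite (_ : (fun _ => _)
        = (fun y => f (lsubmx y)) * (fun y => h (rsubmx y) i' j')).
      apply (@differentiableM _ _ (fun y => f (lsubmx y)) (fun y => h (rsubmx y) i' j')).
        exact (dl f (smooth_on_differentiable oO1 fs y1)).
      exact (dr (fun r => h r i' j') (hd i' j')).
    by apply/funext => z; rewrite /warp block_mxEdr mxE.
- by rewrite /warp tr_block_mx bT linearZ/= hT !trmx0.
- rewrite /warp unitmxE det_ublock unitrM -unitmxE bU detZ unitrM -unitmxE hU andbT.
  by rewrite unitrX// unitfE gt_eqF// f_gt0.
Qed.

Lemma warp_near x : dom x -> \forall y \near x, nondeg_diff warp y.
Proof. by move=> dx; apply: (dom_near dx) => y; exact: nondeg_warp. Qed.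

Lemma warp_derivable2 x : dom x -> forall i j k u,
  derivable (fun y => 'D_(delta_mx 0 k) (fun z => warp z i j) y) x u.
Proof.
move=> dx i j k u.
rewrite (_ : (fun _ => _) = dinner warp (delta_mx 0 k) (delta_mx 0 i) (delta_mx 0 j)).
  exact: derivable_dinner_warp.
apply/funext => y; rewrite /dinner.
rewrite (_ : (fun z => inner warp z (delta_mx 0 i) (delta_mx 0 j)) = (fun z => warp z i j))//.
by apply/funext => z; rewrite /inner trmx_delta -rowE -colE !mxE.
Qed.

(* For f = phi^2 with phi > 0, wsq f is phi'^2 and wacc f is phi phi''. *)
Definition wsq t : R := df t ^+ 2 / (4 * f t).
Definition wacc t : R := ddf t / 2 - df t ^+ 2 / (4 * f t).

(** Pairing with a third vector reduces this to the Koszul formulas of the product and of the fiber.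
    Being 1 or -1, [eps] is its own inverse. *)
Lemma chr_warp x u v : dom x ->
  chr warp x u v = row_mx
    (- (eps * df (lsubmx x) / 2 * inner h (rsubmx x) (rc u) (rc v)))%:M
    (chr h (rsubmx x) (rc u) (rc v)
     + (df (lsubmx x) / (2 * f (lsubmx x))) *: (lc u *: rc v + lc v *: rc u)).
Proof.
move=> dx; have [x1 x2] := dx; have Nx := nondeg_warp dx.
have Hx := smooth_metric_nondeg hs x2.
apply: (@inner_inj _ _ warp x); first by case: Nx.
move=> w; rewrite inner_chr// !dinner_warp// inner_warp// row_mxKl row_mxKr.
have sc (a : R) : (a%:M : 'M[R]_1) 0 0 = a by rewrite mxE eqxx.
rewrite sc innerDl innerZl innerDl !innerZl inner_chr//.
have f0 : f (lsubmx x) != 0 by rewrite gt_eqF// f_gt0.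
move: f0; generalize_atoms; move: (f _) (df _) => F F1 *.
by case: heps => ->; field.
Qed.

(** Both curvatures are expanded by [R4E]; what is left is a rational identity in [f], its two
    derivatives, and fiber data. As in a Gauss equation, [wsq] corrects the curvature of the fiber,
    while [wacc] governs the planes containing the base direction. *)
Lemma curv_warp x u v w : dom x ->
  let y := rsubmx x in let t := lsubmx x in
  curv warp x u v w = row_mx
    (- (eps * wacc t * (lc u * inner h y (rc v) (rc w) - lc v * inner h y (rc u) (rc w))))%:M
    (curv h y (rc u) (rc v) (rc w)
     - (eps * wsq t) *: (inner h y (rc v) (rc w) *: rc u - inner h y (rc u) (rc w) *: rc v)
     + (wacc t / f t * lc w) *: (lc u *: rc v - lc v *: rc u)).
Proof.
move=> dx y t; have [x1 x2] := dx; have Nx := nondeg_warp dx.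
have Hx := smooth_metric_nondeg hs x2; have [_ hT _] := Hx.
apply: (@inner_inj _ _ warp x); first by case: Nx.
move=> z; rewrite [RHS](inner_warp _ _ x1).
(* [X] and [Y] are closed forms of the derivatives of [dinner] and of the products of Christoffel
   vectors of the warped metric, substituted before anything is multiplied out. *)
pose X (a b c d : 'rV[R]_(1 + p)) := lc a * lc b * ddf t * inner h y (rc c) (rc d)
    + lc b * df t * dinner h (rc a) (rc c) (rc d) y
    + lc a * df t * dinner h (rc b) (rc c) (rc d) y
    + f t * 'D_(rc a) (dinner h (rc b) (rc c) (rc d)) y.
pose k := df t / (2 * f t).
pose Y (a b c d : 'rV[R]_(1 + p)) := eps * (eps * df t / 2 * inner h y (rc a) (rc b))
      * (eps * df t / 2 * inner h y (rc c) (rc d))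
    + f t * inner h y (chr h y (rc a) (rc b) + k *: (lc a *: rc b + lc b *: rc a))
        (chr h y (rc c) (rc d) + k *: (lc c *: rc d + lc d *: rc c)).
have XE (a b c d : 'rV[R]_(1 + p)) : 'D_a (dinner warp b c d) x = X a b c d by exact: derive_dinner_warp.
have sc (a : R) : (a%:M : 'M[R]_1) 0 0 = a by rewrite mxE eqxx.
have YE (a b c d : 'rV[R]_(1 + p)) : inner warp x (chr warp x a b) (chr warp x c d) = Y a b c d.
  rewrite (chr_warp a b dx) (chr_warp c d dx) (inner_warp _ _ x1).
  by rewrite !row_mxKl !row_mxKr !sc !mulrN mulNr opprK.
have -> : inner warp x (curv warp x u v w) z = 2^-1 *
   (X u w v z - X u z v w - X v w u z + X v z u w + X u v w z - X v u w z)
   + Y u w v z - Y v w u z.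
  apply: etrans (R4E (warp_near dx) (warp_derivable2 dx) u v w z) _.
  congr (2^-1 * (_ - _ - _ + _ + _ - _) + _ - _);
    [exact: XE|exact: XE|exact: XE|exact: XE|exact: XE|exact: XE|exact: YE|exact: YE].
rewrite /X /Y; rewrite !row_mxKl !row_mxKr !sc -/y -/t.
have R4h := R4E (smooth_metric_near hs x2) (smooth_metric_derivable2 hs x2)
  (rc u) (rc v) (rc w) (rc z).
rewrite -/y /R4 in R4h Hx; move: R4h.
move: (curv h y (rc u) (rc v) (rc w)) => Cv R4h.
rewrite !(innerDl, innerDr, innerNl, innerNr, innerZl, innerZr).
rewrite R4h {R4h}.
have hC a b : inner h y a b = inner h y b a by exact: innerC.
rewrite !(hC _ (chr h y (rc v) (rc z))) !(hC _ (chr h y (rc u) (rc z))).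
rewrite (hC (chr h y (rc v) (rc z)) (chr h y (rc u) (rc w))).
rewrite (hC (chr h y (rc u) (rc z)) (chr h y (rc v) (rc w))).
rewrite !(inner_chr _ _ (rc _) Hx).
have dC a b c : dinner h a b c y = dinner h a c b y by exact: (dinnerC (smooth_metric_near hs x2)).
rewrite ?(dC _ (rc z) (rc u)) ?(dC _ (rc z) (rc v)) ?(dC _ (rc z) (rc w)).
rewrite ?(dC _ (rc w) (rc u)) ?(dC _ (rc w) (rc v)) ?(dC _ (rc v) (rc u)).
rewrite !(hC (rc w) (rc u)) !(hC (rc w) (rc v)) !(hC (rc v) (rc u)).
have f0 : f t != 0 by rewrite gt_eqF// f_gt0.
rewrite /k /wsq /wacc; move: f0; generalize_atoms.
move: (f _) (df _) (ddf _) (lsubmx u 0 0) (lsubmx v 0 0) (lsubmx w 0 0) (lsubmx z 0 0).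
by move=> *; case: heps => ->; field.
Qed.

End WarpedCurvature.

(** * The Ricci tensor *)

Lemma inner_mx (R : realType) n (g : 'rV[R]_n -> 'M[R]_n) x u v :
  inner g x u v = (u *m g x *m v^T) 0 0.
Proof. by []. Qed.

Local Opaque curv inner.

Lemma linear_rV_sum (R : realType) n (f : 'rV[R]_n -> R) w :
  (forall u u' a, f (a *: u + u') = a * f u + f u') ->
  f w = \sum_j w 0 j * f (delta_mx 0 j).
Proof.
move=> fP; have flin : linear f by move=> a u u'; rewrite fP.
pose fM := GRing.isLinear.Build _ _ _ _ _ flin.
pose fL : {linear 'rV[R]_n -> R} := HB.pack f fM.
transitivity (fL (\sum_j w 0 j *: delta_mx 0 j)); first by rewrite -row_sum_delta.
by rewrite linear_sum; apply: eq_bigr => j _; rewrite linearZ.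
Qed.

Section RicciTensor.
Context (R : realType) (n : nat) (O : set 'rV[R]_n) (g : 'rV[R]_n -> 'M[R]_n)
  (gs : smooth_metric O g) (x : 'rV[R]_n) (Ox : O x).
Implicit Types (u v w z : 'rV[R]_n) (a : R).

Let gU : g x \in unitmx. Proof. by case: gs => _ _ _; apply. Qed.
Let gT : (g x)^T = g x. Proof. by case: gs => _ _ + _; apply. Qed.

Lemma R4D4 u v w z z' : R4 g x u v w (z + z') = R4 g x u v w z + R4 g x u v w z'.
Proof. exact: innerDr. Qed.
Lemma R4Z4 a u v w z : R4 g x u v w (a *: z) = a * R4 g x u v w z.
Proof. exact: innerZr. Qed.
(** Linearity is plain in the last argument and reaches the others through the symmetries of the
    tensor. *)
Lemma R4D3 u v w w' z : R4 g x u v (w + w') z = R4 g x u v w z + R4 g x u v w' z.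
Proof. by rewrite !(R4_swap34 gs _ _ _ z Ox) R4D4 opprD. Qed.
Lemma R4Z3 a u v w z : R4 g x u v (a *: w) z = a * R4 g x u v w z.
Proof. by rewrite !(R4_swap34 gs _ _ _ z Ox) R4Z4 mulrN. Qed.
Lemma R4D1 u u' v w z : R4 g x (u + u') v w z = R4 g x u v w z + R4 g x u' v w z.
Proof. by rewrite !(R4_pair gs _ v w z Ox) R4D3. Qed.
Lemma R4Z1 a u v w z : R4 g x (a *: u) v w z = a * R4 g x u v w z.
Proof. by rewrite !(R4_pair gs _ v w z Ox) R4Z3. Qed.
Lemma R4_01 v w z : R4 g x 0 v w z = 0.
Proof. by rewrite -(scale0r 0) R4Z1 mul0r. Qed.
Lemma R4_03 u v z : R4 g x u v 0 z = 0.
Proof. by rewrite -(scale0r 0) R4Z3 mul0r. Qed.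

Lemma curvP3 a u v w w' :
  curv g x u v (a *: w + w') = a *: curv g x u v w + curv g x u v w'.
Proof.
apply: (inner_inj gU) => z; rewrite [RHS]innerDl [X in _ = X + _]innerZl.
by apply: etrans (R4D3 _ _ _ _ _) _; rewrite R4Z3.
Qed.

Lemma ricciE u v : ricci g x u v = \sum_i curv g x (delta_mx 0 i) u v 0 i.
Proof. by apply: eq_bigr => i _; rewrite mxE. Qed.

Lemma ricciP2 a u v v' : ricci g x u (a *: v + v') = a * ricci g x u v + ricci g x u v'.
Proof.
rewrite !ricciE mulr_sumr -big_split; apply: eq_bigr => i _.
by rewrite curvP3 !mxE.
Qed.

(** The basis dual to the coordinate basis with respect to the metric: a trace becomes a sum over
    [delta_mx 0 i] paired with [dual i]. *)
Definition dual (i : 'I_n) : 'rV[R]_n := delta_mx 0 i *m invmx (g x).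

Lemma inner_dual w i : inner g x w (dual i) = w 0 i.
Proof.
rewrite inner_mx /dual trmx_mul trmx_inv gT -!mulmxA [g x *m _]mulmxA mulmxV// mul1mx.
by rewrite trmx_delta -colE mxE.
Qed.

(** The two bases may exchange slots in a trace because the inverse metric is symmetric. *)
Lemma contract_swap (B : 'rV[R]_n -> 'rV[R]_n -> R) :
  (forall v u u' a, B (a *: u + u') v = a * B u v + B u' v) ->
  (forall v u u' a, B v (a *: u + u') = a * B v u + B v u') ->
  \sum_i B (delta_mx 0 i) (dual i) = \sum_i B (dual i) (delta_mx 0 i).
Proof.
move=> Bl Br.
have invT i j : invmx (g x) i j = invmx (g x) j i.
  by rewrite -[in LHS]gT -trmx_inv mxE.
transitivity (\sum_i \sum_j invmx (g x) i j * B (delta_mx 0 i) (delta_mx 0 j)).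
  apply: eq_bigr => i _; rewrite (linear_rV_sum _ (Br (delta_mx 0 i))).
  by apply: eq_bigr => j _; rewrite /dual -rowE mxE.
rewrite exchange_big/=; apply: eq_bigr => j _.
rewrite (linear_rV_sum (f := B^~ _) _ (Bl (delta_mx 0 j))).
by apply: eq_bigr => i _; rewrite /dual -rowE mxE invT.
Qed.

Lemma ricci_R4 u v : ricci g x u v = \sum_i R4 g x (delta_mx 0 i) u v (dual i).
Proof. by rewrite ricciE; apply: eq_bigr => i _; rewrite /R4 inner_dual. Qed.

Lemma ricciC u v : ricci g x u v = ricci g x v u.
Proof.
rewrite ricci_R4 (@contract_swap (fun c d => R4 g x c u v d)) => [|z w w' a|z w w' a]/=;
  [|by rewrite R4D1 R4Z1|by rewrite R4D4 R4Z4].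
rewrite ricci_R4; apply: eq_bigr => i _.
by rewrite (R4_pair gs) // R4_swap12 (R4_swap34 gs) // opprK.
Qed.

Lemma ricciP1 a u u' v : ricci g x (a *: u + u') v = a * ricci g x u v + ricci g x u' v.
Proof. by rewrite !(ricciC _ v) ricciP2. Qed.

Lemma inner_ricci_op u v : inner g x (ricci_op g x u) v = ricci g x u v.
Proof.
rewrite inner_mx /ricci_op mulmxKV// mxE (@linear_rV_sum _ _ (ricci g x u) v (fun w w' a => ricciP2 a u w w')).
by apply: eq_bigr => j _; rewrite !mxE mulrC.
Qed.

Local Opaque ricci_op ricci.

Lemma ricci_opP a u u' : ricci_op g x (a *: u + u') = a *: ricci_op g x u + ricci_op g x u'.
Proof.
apply: (inner_inj gU) => z.
rewrite [RHS]innerDl [X in _ = X + _]innerZl.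
apply: etrans (inner_ricci_op _ _) _; apply: etrans (ricciP1 _ _ _ _) _.
by congr (_ * _ + _); exact: esym (inner_ricci_op _ _).
Qed.

Lemma scalarE : scalar_curv g x = \sum_i ricci_op g x (delta_mx 0 i) 0 i.
Proof. by apply: eq_bigr => i _; rewrite mxE. Qed.

End RicciTensor.

Definition trless (R : realType) n (g : 'rV[R]_n -> 'M[R]_n) x (u : 'rV[R]_n) : 'rV[R]_n :=
  ricci_op g x u - (scalar_curv g x / n%:R) *: u.

(** * Ricci and Weyl tensors of the warped product *)

Section Vec.
Context (R : realType) (p : nat).

Definition vec (a : R) (X : 'rV[R]_p) : 'rV[R]_(1 + p) := row_mx a%:M X.

Lemma vec_l a X : lsubmx (vec a X) 0 0 = a.
Proof. by rewrite row_mxKl mxE eqxx. Qed.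

Lemma vec_r a X : rsubmx (vec a X) = X.
Proof. exact: row_mxKr. Qed.

Lemma vec_eta u : u = vec (lsubmx u 0 0) (rsubmx u).
Proof. by rewrite /vec -mx11_scalar hsubmxK. Qed.

Lemma vecD a b X Y : vec a X + vec b Y = vec (a + b) (X + Y).
Proof. by rewrite /vec add_row_mx -raddfD. Qed.

Lemma vecZ k a X : k *: vec a X = vec (k * a) (k *: X).
Proof. by rewrite /vec scale_row_mx scale_scalar_mx. Qed.

Lemma vecB a b X Y : vec a X - vec b Y = vec (a - b) (X - Y).
Proof. by rewrite -scaleN1r vecZ vecD mulN1r scaleN1r. Qed.

Lemma vec_delta_l : delta_mx 0 (lshift p 0) = vec 1 0.
Proof.
apply/rowP => j; rewrite /vec mxE eqxx/=; case: (split_ordP j) => k ->.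
  by rewrite row_mxEl !ord1 mxE !eqxx.
by rewrite row_mxEr mxE eq_rlshift.
Qed.

Lemma vec_delta_r i : delta_mx 0 (rshift 1 i) = vec 0 (delta_mx 0 i).
Proof.
apply/rowP => j; rewrite /vec mxE eqxx/=; case: (split_ordP j) => k ->.
  by rewrite row_mxEl eq_lrshift !ord1 !mxE mul0rn.
by rewrite row_mxEr mxE eqxx eq_rshift.
Qed.

Lemma sum_vec (F : 'rV[R]_(1 + p) -> 'rV[R]_(1 + p)) :
  \sum_i F (delta_mx 0 i) 0 i
  = lsubmx (F (vec 1 0)) 0 0 + \sum_i rsubmx (F (vec 0 (delta_mx 0 i))) 0 i.
Proof.
rewrite big_split_ord big_ord1 vec_delta_l mxE; congr (_ + _).
by apply: eq_bigr => i _; rewrite vec_delta_r mxE.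
Qed.

End Vec.

Section WarpedTensors.
Context (R : realType) (p : nat) (eps : R) (heps : eps = 1 \/ eps = -1).
Context (O1 : set 'rV[R]_1) (gb : 'rV[R]_1 -> 'M[R]_1)
  (gbs : smooth_metric O1 gb) (gbE : forall t, O1 t -> gb t 0 0 = eps).
Context (f : 'rV[R]_1 -> R) (fs : smooth_on O1 f) (f_gt0 : forall t, O1 t -> 0 < f t).
Context (O2 : set 'rV[R]_p) (h : 'rV[R]_p -> 'M[R]_p) (hs : smooth_metric O2 h).
Context (x : 'rV[R]_(1 + p)) (x1 : O1 (lsubmx x)) (x2 : O2 (rsubmx x)).

Local Notation g := (warp gb f h).
Local Notation y := (rsubmx x).
Local Notation F := (f (lsubmx x)).
Local Notation w := (wacc f (lsubmx x)).
Local Notation v := (wsq f (lsubmx x)).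
Local Notation H := (inner h y).

Lemma inner_vec a b X Y : inner g x (vec a X) (vec b Y) = eps * a * b + F * H X Y.
Proof. by rewrite (inner_warp gbE f h _ _ x1) !vec_l !vec_r. Qed.

Lemma curv_vec a b c X Y Z : curv g x (vec a X) (vec b Y) (vec c Z) = vec
  (- (eps * w * (a * H Y Z - b * H X Z)))
  (curv h y X Y Z - (eps * v) *: (H Y Z *: X - H X Z *: Y)
   + (w / F * c) *: (a *: Y - b *: X)).
Proof.
by rewrite (curv_warp heps gbs gbE fs f_gt0 hs _ _ _ (conj x1 x2)) !vec_l !vec_r.
Qed.

Let F0 : F != 0. Proof. by rewrite gt_eqF// f_gt0. Qed.

Lemma ricci_vec a b X Y : ricci g x (vec a X) (vec b Y)
  = ricci h y X Y - eps * (w + (p%:R - 1) * v) * H X Y - p%:R * w / F * a * b.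
Proof.
rewrite ricciE (sum_vec (fun z => curv g x z (vec a X) (vec b Y))) curv_vec vec_l.
have -> : H 0 Y = 0 by rewrite -(scale0r 0) innerZl mul0r.
transitivity (- (eps * w * H X Y) + \sum_i (curv h y (delta_mx 0 i) X Y 0 i
   - eps * v * H X Y - - (eps * v * (H (delta_mx 0 i) Y * X 0 i)) - w / F * a * b)).
  congr (_ + _); first by rewrite mul1r mulr0 subr0.
  apply: eq_bigr => i _; rewrite curv_vec vec_r.
  move: (curv h y (delta_mx 0 i) X Y) => C; rewrite !mxE !eqxx/=.
  by generalize_atoms => *; ring.
rewrite !sumrB ricciE !sumr_const card_ord sumrN -mulr_sumr.
have -> : \sum_i H (delta_mx 0 i) Y * X 0 i = H X Y.
  rewrite (@linear_rV_sum _ _ (fun z => H z Y) X) => [|u u' k]; last first.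
    by rewrite innerDl innerZl.
  by apply: eq_bigr => i _; rewrite mulrC.
rewrite -(mulr_natr (eps * v * H X Y)) -(mulr_natr (w / F * a * b)); move: (\sum_i _) => S.
by move: F0; generalize_atoms; move: w v F (p%:R : R) => *; field.
Qed.

Local Notation rho := (ricci_op h y).
Local Notation kt := (scalar_curv h y).

Lemma ricci_op_vec a X : ricci_op g x (vec a X) = vec (- (p%:R * w / F * eps * a))
  (F^-1 *: (rho X - (eps * (w + (p%:R - 1) * v)) *: X)).
Proof.
have gU : g x \in unitmx.
  by have [] := nondeg_warp gbs fs f_gt0 hs (conj x1 x2).
apply: (can_inj (mulmxK gU)); rewrite /ricci_op mulmxKV//.
apply/rowP => j; rewrite mxE.
transitivity (inner g x (vec (- (p%:R * w / F * eps * a))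
  (F^-1 *: (rho X - (eps * (w + (p%:R - 1) * v)) *: X))) (delta_mx 0 j)); last first.
  by rewrite inner_mx trmx_delta -colE mxE.
rewrite [delta_mx 0 j]vec_eta; move: (lsubmx _ 0 0) (rsubmx _) => b Y.
rewrite ricci_vec inner_vec innerZl innerDl innerNl innerZl.
rewrite [inner h y (rho X) Y](inner_ricci_op hs x2).
move: F0; generalize_atoms; move: w v F (p%:R : R).
by move=> *; case: heps => ->; field.
Qed.

Lemma scalar_warp : scalar_curv g x
  = - (p%:R * w / F * eps) + F^-1 * (kt - eps * (w + (p%:R - 1) * v) * p%:R).
Proof.
rewrite scalarE (sum_vec (ricci_op g x)) ricci_op_vec vec_l mulr1; congr (_ + _).
under eq_bigr do rewrite ricci_op_vec vec_r mxE.
rewrite -mulr_sumr; congr (_ * _); rewrite scalarE.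
transitivity (\sum_(i < p) (rho (delta_mx 0 i) 0 i - eps * (w + (p%:R - 1) * v))).
  by apply: eq_bigr => i _; rewrite !mxE !eqxx mulr1.
by rewrite big_split/= sumr_const card_ord mulNrn mulr_natr.
Qed.

Local Notation P := (trless h y).

(** [w] and [v] drop out because the warped metric is conformal to the product of a line with the
    fiber, and the Weyl operator is a conformal invariant. *)
Lemma weyl_vec a b c X Y Z : (2 < p)%N -> weyl_op g x (vec a X) (vec b Y) (vec c Z) = vec
  (- ((p%:R - 1)^-1 * (a * H (P Y) Z - b * H (P X) Z)))
  (curv h y X Y Z - (p%:R - 1)^-1 *:
     (H (P Y) Z *: X - H X Z *: P Y + H Y Z *: P X - H (P X) Z *: Y
      + (kt / p%:R) *: (H Y Z *: X - H X Z *: Y))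
   + (c * eps / ((p%:R - 1) * F)) *: (a *: P Y - b *: P X)).
Proof.
move=> p2; have p0 : p%:R != 0 :> R by rewrite pnatr_eq0; case: (p) p2.
have p1 : p%:R - 1 != 0 :> R.
  by rewrite subr_eq0 (eqr_nat R p 1); case: (p) p2 => [|[]].
rewrite /weyl_op curv_vec !ricci_op_vec scalar_warp /wedge_op !inner_vec.
rewrite !(vecZ, vecB, vecD).
have -> : (1 + p)%:R - 2 = p%:R - 1 :> R by rewrite natrD; ring.
have -> : (1 + p)%:R - 1 = p%:R :> R by rewrite natrD; ring.
have E u z : H (F^-1 *: (rho u - (eps * (w + (p%:R - 1) * v)) *: u)) z
   = F^-1 * (H (rho u) z - eps * (w + (p%:R - 1) * v) * H u z).
  by rewrite innerZl innerDl innerNl innerZl.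
have T u z : H (P u) z = H (rho u) z - kt / p%:R * H u z.
  by rewrite innerDl innerNl innerZl.
rewrite !E !T /trless; congr vec.
  move: F0 p0 p1; generalize_atoms; move: w v F kt (p%:R : R).
  by move=> *; case: heps => ->; field; apply/and3P.
move: (rho X) (rho Y) (curv h y X Y Z) => rX rY C.
apply/rowP => i; rewrite !mxE.
move: F0 p0 p1; generalize_atoms.
move: w v F kt (p%:R : R) (rX 0 i) (rY 0 i) (C 0 i) (X 0 i) (Y 0 i).
by move=> *; case: heps => ->; field; apply/and3P.
Qed.

End WarpedTensors.

(** * Algebra of the curvature condition *)

(** Proves an equation by displaying the difference of its sides as a multiple [k] of that of a
    known one, which leaves an identity for [ring] or [field]. *)
Lemma eq_combination (R : realFieldType) (k a b c d : R) :
  a = b -> c - d = k * (a - b) -> c = d.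
Proof. by move=> ->; rewrite subrr mulr0 => /eqP; rewrite subr_eq0 => /eqP. Qed.

Section CurvatureAlgebra.
Context (R : realFieldType) (W : lmodType R).
Context (H : W -> W -> R) (Rt : W -> W -> W -> W) (P : W -> W).

(** [GH] is the tensor G of the form [H], and [BH] is [Rt] with its last index lowered. The module
    is abstract, so that the algebra rests on the listed symmetries and no matrix or derivative
    enters the normalization. *)
Definition GH (a b c d : W) : R := H b c * H a d - H a c * H b d.
Definition BH (a b c d : W) : R := H (Rt a b c) d.

Context (HP1 : forall k a a' b, H (k *: a + a') b = k * H a b + H a' b)
  (HC : forall a b, H a b = H b a)
  (BP1 : forall k a a' b c d, BH (k *: a + a') b c d = k * BH a b c d + BH a' b c d)
  (B12 : forall a b c d, BH a b c d = - BH b a c d)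
  (B34 : forall a b c d, BH a b c d = - BH a b d c)
  (Bpair : forall a b c d, BH a b c d = BH c d a b)
  (PP : forall k a b, P (k *: a + b) = k *: P a + P b)
  (Psym : forall a b, H (P a) b = H a (P b))
  (Rt01 : forall b c, Rt 0 b c = 0)
  (Rt03 : forall a b, Rt a b 0 = 0).

Section Linearity.
Context (U V : lmodType R) (f : U -> V) (fP : forall k a b, f (k *: a + b) = k *: f a + f b).

Lemma lin_D a b : f (a + b) = f a + f b.
Proof. by rewrite -[a]scale1r fP !scale1r. Qed.

Lemma lin_0 : f 0 = 0.
Proof. by apply: (addrI (f 0)); rewrite -lin_D !addr0. Qed.

Lemma lin_Z k a : f (k *: a) = k *: f a.
Proof. by rewrite -[k *: a]addr0 fP lin_0 addr0. Qed.

Lemma lin_N a : f (- a) = - f a.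
Proof. by rewrite -scaleN1r lin_Z scaleN1r. Qed.

End Linearity.

Let BP2 k a b b' c d : BH a (k *: b + b') c d = k * BH a b c d + BH a b' c d.
Proof. by rewrite B12 BP1 opprD (B12 a b) (B12 a b') mulrN. Qed.
Let BP3 k a b c c' d : BH a b (k *: c + c') d = k * BH a b c d + BH a b c' d.
Proof. by rewrite Bpair BP1 (Bpair c) (Bpair c'). Qed.
Let BP4 k a b c d d' : BH a b c (k *: d + d') = k * BH a b c d + BH a b c d'.
Proof. by rewrite B34 BP3 opprD (B34 a b c d) (B34 a b c d') mulrN. Qed.

Let HD1 a a' b : H (a + a') b = H a b + H a' b.
Proof. exact: (@lin_D _ R^o (H^~ b) (fun k a a' => HP1 k a a' b)). Qed.
Let HZ1 k a b : H (k *: a) b = k * H a b.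
Proof. exact: (@lin_Z _ R^o (H^~ b) (fun k a a' => HP1 k a a' b)). Qed.
Let HN1 a b : H (- a) b = - H a b.
Proof. exact: (@lin_N _ R^o (H^~ b) (fun k a a' => HP1 k a a' b)). Qed.
Let H01 b : H 0 b = 0.
Proof. exact: (@lin_0 _ R^o (H^~ b) (fun k a a' => HP1 k a a' b)). Qed.
Let HD2 a b b' : H a (b + b') = H a b + H a b'.
Proof. by rewrite HC HD1 !(HC a). Qed.
Let HZ2 k a b : H a (k *: b) = k * H a b.
Proof. by rewrite HC HZ1 (HC a). Qed.
Let HN2 a b : H a (- b) = - H a b.
Proof. by rewrite HC HN1 (HC a). Qed.
Let H02 a : H a 0 = 0. Proof. by rewrite HC H01. Qed.

Let BD1 a a' b c d : BH (a + a') b c d = BH a b c d + BH a' b c d.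
Proof. exact: (@lin_D _ R^o _ (fun k a a' => BP1 k a a' b c d)). Qed.
Let BZ1 k a b c d : BH (k *: a) b c d = k * BH a b c d.
Proof. exact: (@lin_Z _ R^o _ (fun k a a' => BP1 k a a' b c d)). Qed.
Let BN1 a b c d : BH (- a) b c d = - BH a b c d.
Proof. exact: (@lin_N _ R^o _ (fun k a a' => BP1 k a a' b c d)). Qed.
Let B01 b c d : BH 0 b c d = 0.
Proof. exact: (@lin_0 _ R^o _ (fun k a a' => BP1 k a a' b c d)). Qed.
Let BD2 a b b' c d : BH a (b + b') c d = BH a b c d + BH a b' c d.
Proof. exact: (@lin_D _ R^o _ (fun k b b' => BP2 k a b b' c d)). Qed.
Let BZ2 k a b c d : BH a (k *: b) c d = k * BH a b c d.
Proof. exact: (@lin_Z _ R^o _ (fun k b b' => BP2 k a b b' c d)). Qed.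
Let BN2 a b c d : BH a (- b) c d = - BH a b c d.
Proof. exact: (@lin_N _ R^o _ (fun k b b' => BP2 k a b b' c d)). Qed.
Let B02 a c d : BH a 0 c d = 0.
Proof. exact: (@lin_0 _ R^o _ (fun k b b' => BP2 k a b b' c d)). Qed.
Let BD3 a b c c' d : BH a b (c + c') d = BH a b c d + BH a b c' d.
Proof. exact: (@lin_D _ R^o _ (fun k c c' => BP3 k a b c c' d)). Qed.
Let BZ3 k a b c d : BH a b (k *: c) d = k * BH a b c d.
Proof. exact: (@lin_Z _ R^o _ (fun k c c' => BP3 k a b c c' d)). Qed.
Let BN3 a b c d : BH a b (- c) d = - BH a b c d.
Proof. exact: (@lin_N _ R^o _ (fun k c c' => BP3 k a b c c' d)). Qed.
Let B03 a b d : BH a b 0 d = 0.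
Proof. exact: (@lin_0 _ R^o _ (fun k c c' => BP3 k a b c c' d)). Qed.
Let BD4 a b c d d' : BH a b c (d + d') = BH a b c d + BH a b c d'.
Proof. exact: (@lin_D _ R^o _ (fun k d d' => BP4 k a b c d d')). Qed.
Let BZ4 k a b c d : BH a b c (k *: d) = k * BH a b c d.
Proof. exact: (@lin_Z _ R^o _ (fun k d d' => BP4 k a b c d d')). Qed.
Let BN4 a b c d : BH a b c (- d) = - BH a b c d.
Proof. exact: (@lin_N _ R^o _ (fun k d d' => BP4 k a b c d d')). Qed.
Let B04 a b c : BH a b c 0 = 0.
Proof. exact: (@lin_0 _ R^o _ (fun k d d' => BP4 k a b c d d')). Qed.

Let PD a b : P (a + b) = P a + P b. Proof. exact: lin_D PP a b. Qed.
Let PZ k a : P (k *: a) = k *: P a. Proof. exact: lin_Z PP k a. Qed.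
Let PN a : P (- a) = - P a. Proof. exact: lin_N PP a. Qed.
Let P0 : P 0 = 0. Proof. exact: lin_0 PP. Qed.

Let HRt a b c d : H (Rt a b c) d = BH a b c d. Proof. by []. Qed.
Let HPRt a b c d : H (P (Rt a b c)) d = BH a b c (P d). Proof. by rewrite Psym. Qed.

Let HRt2 a b c d : H d (Rt a b c) = BH a b c d. Proof. by rewrite HC. Qed.

Let mlin := (Rt01, Rt03, H01, H02, P0, mul0r, mulr0, mul1r, mulr1, scale0r,
  scaler0, scale1r, oppr0, add0r, addr0, HD1, HZ1, HN1, H01, HD2, HZ2, HN2, H02, BD1, BZ1, BN1, B01,
  BD2, BZ2, BN2, B02, BD3, BZ3, BN3, B03, BD4, BZ4, BN4, B04, PD, PZ, PN, P0,
  HPRt, HRt, HRt2).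

(* The pair (a, X) stands for the vector with base component a and fiber
   component X; q is the dimension of the fiber and kq the ratio of its scalar
   curvature to q. *)
Context (eps : R) (heps : eps = 1 \/ eps = -1) (w v F q kq : R)
  (F0 : F != 0) (q1 : q - 1 != 0).
Implicit Types U V Z : (R * W)%type.

Definition pair_inner U V : R := eps * U.1 * V.1 + F * H U.2 V.2.

Definition pair_curv U V Z : R * W :=
  (- (eps * w * (U.1 * H V.2 Z.2 - V.1 * H U.2 Z.2)),
   Rt U.2 V.2 Z.2 - (eps * v) *: (H V.2 Z.2 *: U.2 - H U.2 Z.2 *: V.2)
   + (w / F * Z.1) *: (U.1 *: V.2 - V.1 *: U.2)).

Definition pair_weyl U V Z : R * W :=
  (- ((q - 1)^-1 * (U.1 * H (P V.2) Z.2 - V.1 * H (P U.2) Z.2)),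
   Rt U.2 V.2 Z.2 - (q - 1)^-1 *:
     (H (P V.2) Z.2 *: U.2 - H U.2 Z.2 *: P V.2 + H V.2 Z.2 *: P U.2
      - H (P U.2) Z.2 *: V.2 + kq *: (H V.2 Z.2 *: U.2 - H U.2 Z.2 *: V.2))
   + (Z.1 * eps / ((q - 1) * F)) *: (U.1 *: P V.2 - V.1 *: P U.2)).

(** The formula of [ricci_vec] with the Ricci tensor of the fiber split into [P] and [kq] times the
    metric. *)
Definition pair_ricci U V : R :=
  H (P U.2) V.2 + (kq - eps * (w + (q - 1) * v)) * H U.2 V.2 - q * w / F * U.1 * V.1.

Definition pair_wedgeS U V Z : R * W :=
  (pair_ricci V Z * U.1 - pair_ricci U Z * V.1,
   pair_ricci V Z *: U.2 - pair_ricci U Z *: V.2).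

Definition pair_R U1 U2 U3 U4 : R := pair_inner (pair_curv U1 U2 U3) U4.
Definition pair_C U1 U2 U3 U4 : R := pair_inner (pair_weyl U1 U2 U3) U4.

Definition pair_act (E : R * W -> R * W) (T : R * W -> R * W -> R * W -> R * W -> R)
    U1 U2 U3 U4 : R :=
  - (T (E U1) U2 U3 U4 + T U1 (E U2) U3 U4 + T U1 U2 (E U3) U4 + T U1 U2 U3 (E U4)).

Definition pair_QSR U1 U2 U3 U4 U V : R :=
  pair_act (pair_wedgeS U V) pair_R U1 U2 U3 U4.

Definition pair_lhs U1 U2 U3 U4 U V : R :=
  pair_act (pair_curv U V) pair_C U1 U2 U3 U4
  - pair_act (pair_weyl U V) pair_R U1 U2 U3 U4.

Let s : R := kq - eps * (q - 1) * v.

(** This is Q(H, A)(Y, Z; U, V) for the symmetric form A(X, Y) = H(P X, Y). *)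
Definition QHP (Y Z U V : W) : R := GH (P Z) Y U V + GH (P Y) Z U V.

Lemma pair_RE a b c d (X Y Z T : W) :
  pair_R (a, X) (b, Y) (c, Z) (d, T) = - w * (a * H Y Z - b * H X Z) * d
    + F * (BH X Y Z T - eps * v * GH X Y Z T) + w * c * (a * H Y T - b * H X T).
Proof.
rewrite /pair_R /pair_inner /pair_curv /GH /= !mlin.
by move: (BH X Y Z T) => B; case: heps => ->; field.
Qed.

Lemma pair_CE a b c d (X Y Z T : W) :
  pair_C (a, X) (b, Y) (c, Z) (d, T) =
    - eps / (q - 1) * (a * H (P Y) Z - b * H (P X) Z) * d
    + F * (BH X Y Z T - (q - 1)^-1 * (H (P Y) Z * H X T - H X Z * H (P Y) T
      + H Y Z * H (P X) T - H (P X) Z * H Y T + kq * GH X Y Z T))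
    + eps / (q - 1) * c * (a * H (P Y) T - b * H (P X) T).
Proof.
rewrite /pair_C /pair_inner /pair_weyl /GH /= !mlin.
by move: (BH X Y Z T) => B; case: heps => ->; field; apply/andP.
Qed.

(** In the names that follow, [T] in the first or last place marks the base vector [(1, 0)], and the
    other letters mark fiber vectors. *)
Lemma pair_curv_TVT (V : W) : pair_curv (1, 0) (0, V) (1, 0) = (0, (w / F) *: V).
Proof. by rewrite /pair_curv/= !mlin. Qed.

Lemma pair_curv_TVX (V X : W) : pair_curv (1, 0) (0, V) (0, X) = (- (eps * w * H V X), 0).
Proof. by rewrite /pair_curv/= !mlin. Qed.

Lemma pair_weyl_TVT (V : W) :
  pair_weyl (1, 0) (0, V) (1, 0) = (0, (eps / ((q - 1) * F)) *: P V).
Proof. by rewrite /pair_weyl/= !mlin. Qed.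

Lemma pair_weyl_TVX (V X : W) :
  pair_weyl (1, 0) (0, V) (0, X) = (- ((q - 1)^-1 * H (P V) X), 0).
Proof. by rewrite /pair_weyl/= !mlin. Qed.

Lemma pair_wedgeS_TVT (V : W) :
  pair_wedgeS (1, 0) (0, V) (1, 0) = (0, (q * w / F) *: V).
Proof.
by rewrite /pair_wedgeS /pair_ricci/= !mlin scaleNr opprK.
Qed.

Lemma pair_wedgeS_TVX (V X : W) :
  pair_wedgeS (1, 0) (0, V) (0, X)
  = (H (P V) X + (kq - eps * (w + (q - 1) * v)) * H V X, 0).
Proof. by rewrite /pair_wedgeS /pair_ricci/= !mlin. Qed.

Lemma pair_curv_XXX (X Y Z : W) : pair_curv (0, X) (0, Y) (0, Z)
  = (0, Rt X Y Z - (eps * v) *: (H Y Z *: X - H X Z *: Y)).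
Proof. by rewrite /pair_curv/= !mlin. Qed.

Lemma pair_weyl_XXX (X Y Z : W) : pair_weyl (0, X) (0, Y) (0, Z)
  = (0, Rt X Y Z - (q - 1)^-1 *: (H (P Y) Z *: X - H X Z *: P Y + H Y Z *: P X
      - H (P X) Z *: Y + kq *: (H Y Z *: X - H X Z *: Y))).
Proof. by rewrite /pair_weyl/= !mlin. Qed.

Lemma pair_wedgeS_XXX (X Y Z : W) : pair_wedgeS (0, X) (0, Y) (0, Z)
  = (0, (H (P Y) Z + (kq - eps * (w + (q - 1) * v)) * H Y Z) *: X
      - (H (P X) Z + (kq - eps * (w + (q - 1) * v)) * H X Z) *: Y).
Proof. by rewrite /pair_wedgeS /pair_ricci/= !mlin. Qed.

Lemma pair_curv_XXT (X Y : W) : pair_curv (0, X) (0, Y) (1, 0) = (0, 0).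
Proof. by rewrite /pair_curv/= !mlin. Qed.

Lemma pair_weyl_XXT (X Y : W) : pair_weyl (0, X) (0, Y) (1, 0) = (0, 0).
Proof. by rewrite /pair_weyl/= !mlin. Qed.

Lemma pair_wedgeS_XXT (X Y : W) : pair_wedgeS (0, X) (0, Y) (1, 0) = (0, 0).
Proof. by rewrite /pair_wedgeS /pair_ricci/= !mlin. Qed.

(* Normalizing the summands one at a time is much faster than normalizing the sum. *)
Ltac expand_pairs :=
  repeat match goal with
  | |- context [pair_C ?x ?y ?z ?t] =>
      let E := fresh in
      eassert (E : pair_C x y z t = _) by (rewrite pair_CE /GH !mlin; reflexivity);
      rewrite E; clear E
  | |- context [pair_R ?x ?y ?z ?t] =>
      let E := fresh in
      eassert (E : pair_R x y z t = _) by (rewrite pair_RE /GH !mlin; reflexivity);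
      rewrite E; clear E
  end.

(** On this component R is -w times H, so Q(S,R) becomes -w Q(S,H) = w Q(H,S), and the multiple of H
    inside S drops out. *)
Lemma pair_QSR_TYZT (Y Z U V : W) :
  pair_QSR (1, 0) (0, Y) (0, Z) (1, 0) (0, U) (0, V) = w * QHP Y Z U V.
Proof.
rewrite /pair_QSR /pair_act !pair_wedgeS_XXT !pair_wedgeS_XXX; expand_pairs.
rewrite /QHP /GH (Psym V Y) (Psym U Y) (Psym V Z) (Psym U Z) !(HC _ (P _)).
by rewrite !(HC V) !(HC U); ring.
Qed.

(** The endomorphisms of [U] and [V] kill the base vector. The Weyl one is skew for H and R is a
    multiple of H here, so C.R contributes nothing; in R.C the curvature acts on a multiple of
    [P]. *)
Lemma condition_TYZT L (Y Z U V : W) :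
  pair_lhs (1, 0) (0, Y) (0, Z) (1, 0) (0, U) (0, V)
    = L * pair_QSR (1, 0) (0, Y) (0, Z) (1, 0) (0, U) (0, V) ->
  BH (P Z) Y U V + BH (P Y) Z U V - eps * v * QHP Y Z U V
  = - (q - 1) * L * (eps * w) * QHP Y Z U V.
Proof.
rewrite pair_QSR_TYZT.
rewrite /pair_lhs /pair_act !pair_curv_XXT !pair_curv_XXX !pair_weyl_XXT !pair_weyl_XXX.
expand_pairs.
have E a b c d : BH a b c (P d) = - BH (P d) c a b by rewrite B34 Bpair.
rewrite !E /QHP /GH.
rewrite !(HC _ (P _)) ?(Psym V Y) ?(Psym U Y) ?(Psym V Z) ?(Psym U Z) !(HC _ (P _)).
rewrite ?(HC V) ?(HC U) ?(B34 U V Z Y) => e.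
by apply: (eq_combination (k := - eps * (q - 1)) e); case: heps => ->; field.
Qed.

(** With the base vector among its arguments each endomorphism just exchanges base and fiber
    directions, so the relation is linear in the curvature of the fiber. *)
Lemma condition_TYZX L (V Y Z X : W) :
  pair_lhs (1, 0) (0, Y) (0, Z) (0, X) (1, 0) (0, V)
    = L * pair_QSR (1, 0) (0, Y) (0, Z) (0, X) (1, 0) (0, V) ->
  BH (P V) Y Z X - eps * v * GH (P V) Y Z X
  = (q - 1) * (eps * w) * (1 - L * q) * (BH V Y Z X - eps * v * GH V Y Z X)
    + eps * w * ((q - 1) * L - 2) * GH (P V) Y Z X
    + (q - 1) * (eps * w) * (L * (s - eps * w) - s / (q - 1)) * GH V Y Z X.
Proof.
rewrite /pair_lhs /pair_QSR /pair_act !pair_curv_TVT !pair_curv_TVX.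
rewrite !pair_weyl_TVT !pair_weyl_TVX !pair_wedgeS_TVT !pair_wedgeS_TVX.
expand_pairs; rewrite /GH /s => e.
by apply: (eq_combination (k := eps * (q - 1)) e); case: heps => ->; field; apply/andP.
Qed.

(** The part quadratic in the curvature of the fiber is common to R.C and C.R and cancels; where [P]
    meets the curvature, the hypothesis replaces it by metric terms. The final rewriting only sorts
    arguments so that [field] sees equal atoms. *)
Lemma condition_XXXX (a b c d U V : W) : w = 0 ->
  (forall X Y Z T : W, BH (P X) Y Z T = eps * v * GH (P X) Y Z T) ->
  pair_lhs (0, a) (0, b) (0, c) (0, d) (0, U) (0, V)
  = (q - 1)^-1 * pair_QSR (0, a) (0, b) (0, c) (0, d) (0, U) (0, V).
Proof.
move=> w0 PB.
have B_P1 (X Y Z T : W) : BH (P X) Y Z T = eps * v * (H Y Z * H (P X) T - H (P X) Z * H Y T).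
  exact: PB.
have B_P2 (X Y Z T : W) : BH Y (P X) Z T = - (eps * v * (H Y Z * H (P X) T - H (P X) Z * H Y T)).
  by rewrite B12 B_P1.
have B_P3 (X Y Z T : W) : BH Z T (P X) Y = eps * v * (H Y Z * H (P X) T - H (P X) Z * H Y T).
  by rewrite Bpair B_P1.
have B_P4 (X Y Z T : W) : BH Z T Y (P X) = - (eps * v * (H Y Z * H (P X) T - H (P X) Z * H Y T)).
  by rewrite B34 B_P3.
have PC (X Y : W) : H (P X) Y = H (P Y) X by rewrite Psym HC.
rewrite /pair_lhs /pair_QSR /pair_act !pair_curv_XXX !pair_weyl_XXX !pair_wedgeS_XXX.
expand_pairs; rewrite w0.
rewrite !(B_P1, B_P2, B_P3, B_P4) !(HC _ (P _)).
rewrite ?(HC b a) ?(HC c a) ?(HC d a) ?(HC U a) ?(HC V a) ?(HC c b) ?(HC d b) ?(HC U b) ?(HC V b) ?(HC d c) ?(HC U c) ?(HC V c) ?(HC U d) ?(HC V d) ?(HC V U).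
rewrite ?(PC b a) ?(PC c a) ?(PC d a) ?(PC U a) ?(PC V a) ?(PC c b) ?(PC d b) ?(PC U b) ?(PC V b) ?(PC d c) ?(PC U c) ?(PC V c) ?(PC U d) ?(PC V d) ?(PC V U).
rewrite ?(B34 U V b a) ?(B34 U V c a) ?(B34 U V d a) ?(B34 U V c b) ?(B34 U V d b) ?(B34 U V d c).
by case: heps => ->; field.
Qed.

(** For [w = 0] both R and S annihilate the base vector. *)
Lemma pair_QSR_flat U1 U2 U3 U4 U V : w = 0 ->
  pair_QSR U1 U2 U3 U4 U V
  = pair_QSR (0, U1.2) (0, U2.2) (0, U3.2) (0, U4.2) (0, U.2) (0, V.2).
Proof.
move=> w0; case: U1 U2 U3 U4 U V => [? ?] [? ?] [? ?] [? ?] [? ?] [? ?].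
rewrite /pair_QSR /pair_act /pair_wedgeS /pair_ricci/= !pair_RE w0.
by rewrite !(oppr0, mul0r, mulr0, subr0, add0r, addr0).
Qed.

Section ConditionHolds.
Context (L : R) (cond : forall U1 U2 U3 U4 U V,
  pair_lhs U1 U2 U3 U4 U V = L * pair_QSR U1 U2 U3 U4 U V).

(** In the sum of [e2] and [e3] the terms without [P] are skew in the exchanged arguments and
    cancel. Compared with [e1], and divided by eps w Q(H,P), the sum reads -(q - 1) L = (q - 1) L -
    2. *)
Lemma condition_value (X Y Z T : W) : w != 0 -> QHP X Y Z T != 0 -> L = (q - 1)^-1.
Proof.
move=> w0 Q0.
have e1 := condition_TYZT (cond (1, 0) (0, X) (0, Y) (1, 0) (0, Z) (0, T)).
have e2 := condition_TYZX (cond (1, 0) (0, X) (0, Z) (0, T) (1, 0) (0, Y)).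
have e3 := condition_TYZX (cond (1, 0) (0, Y) (0, Z) (0, T) (1, 0) (0, X)).
have G12 a b c d : GH a b c d = - GH b a c d by rewrite /GH opprB.
have e : (2 * eps * w) * ((q - 1) * L - 1) * QHP X Y Z T = 0.
  move: e1 e2 e3; rewrite (B12 Y X) (G12 Y X) /QHP.
  move: (BH (P Y) _ _ _) (BH (P X) _ _ _) (GH (P Y) _ _ _) (GH (P X) _ _ _).
  move: (BH X Y Z T) (GH X Y Z T) => b0 g0 b1 b2 g1 g2 e1 e2 e3.
  have e4 := esym e1; rewrite (_ : b1 + b2 - eps * v * (g1 + g2)
     = (b1 - eps * v * g1) + (b2 - eps * v * g2)) in e4; last by ring.
  by rewrite e2 e3 in e4; apply: (eq_combination (k := - 1) e4); field.
move/eqP: e; rewrite !mulf_eq0 (negPf Q0) (negPf w0) pnatr_eq0 !orbF/=.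
have -> : (eps == 0) = false by apply/negbTE; case: heps => ->; rewrite ?oppr_eq0 oner_eq0.
by rewrite subr_eq0 => /eqP e; apply: (mulfI q1); rewrite e divff.
Qed.

(** For this L the relation factors: the left side is the tensor BH + eps (w - v) GH evaluated with
    (P + eps w) V in its first slot. *)
Lemma condition_null (V Y Z X : W) : L = (q - 1)^-1 ->
  BH (P V) Y Z X + eps * w * BH V Y Z X + eps * (w - v) * GH (P V) Y Z X
  + w * (w - v) * GH V Y Z X = 0.
Proof.
move=> Lq.
have e := condition_TYZX (cond (1, 0) (0, Y) (0, Z) (0, X) (1, 0) (0, V)).
rewrite Lq /s in e; apply: (eq_combination (k := 1) e).
move: (BH _ _ _ _) (BH _ _ _ _) (GH _ _ _ _) (GH _ _ _ _) => b1 b2 g1 g2.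
by case: heps => ->; field.
Qed.

End ConditionHolds.

End CurvatureAlgebra.

(** * The curvature condition at a point *)

Section Contractions.
Context (R : realType) (n : nat) (O : set 'rV[R]_n) (g : 'rV[R]_n -> 'M[R]_n)
  (gs : smooth_metric O g) (x : 'rV[R]_n) (Ox : O x).
Implicit Types (a b : 'rV[R]_n).

Let gT : (g x)^T = g x. Proof. by case: gs => _ _ + _; apply. Qed.

Local Notation e i := (delta_mx 0 i : 'rV[R]_n).
Local Notation e' i := (dual g x i).

Lemma sum_inner_dual a b :
  \sum_i inner g x a (e i) * inner g x (e' i) b = inner g x a b.
Proof.
rewrite (@linear_rV_sum _ _ (inner g x a) b) => [|u u' k]; last first.
  by rewrite innerDr innerZr.
apply: eq_bigr => i _; rewrite (innerC (e' i) b gT) (inner_dual gs Ox).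
by rewrite mulrC.
Qed.

Lemma sum_dual_inner a b :
  \sum_i inner g x (e i) a * inner g x b (e' i) = inner g x b a.
Proof.
rewrite (innerC b a gT) -[RHS]sum_inner_dual; apply: eq_bigr => i _.
by rewrite (innerC (e i) a gT) (innerC b _ gT).
Qed.

Lemma sum_inner : \sum_i inner g x (e i) (e' i) = n%:R.
Proof.
transitivity (\sum_(i < n) (1 : R)); last by rewrite sumr_const card_ord.
by apply: eq_bigr => i _; rewrite (inner_dual gs Ox) mxE !eqxx.
Qed.

Local Notation P := (trless g x).

Lemma trless_inner a b :
  inner g x (P a) b = ricci g x a b - scalar_curv g x / n%:R * inner g x a b.
Proof.
rewrite innerDl innerNl innerZl; congr (_ - _).
exact: (inner_ricci_op gs Ox).
Qed.

Lemma trless_sym a b : inner g x (P a) b = inner g x a (P b).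
Proof.
rewrite [RHS](innerC _ _ gT) !trless_inner (ricciC gs Ox b a).
by rewrite (innerC b a gT).
Qed.

Lemma trlessP k a b : P (k *: a + b) = k *: P a + P b.
Proof.
rewrite /trless (ricci_opP gs Ox); move: (ricci_op _ _ _) (ricci_op _ _ _) => A B.
by apply/rowP => i; rewrite !mxE; ring.
Qed.

Lemma sum_trless : n%:R != 0 :> R -> \sum_i inner g x (P (e i)) (e' i) = 0.
Proof.
move=> n0.
transitivity (\sum_i (ricci_op g x (e i) 0 i - scalar_curv g x / n%:R)).
  apply: eq_bigr => i _; rewrite (inner_dual gs Ox) /trless.
  by move: (ricci_op _ _ _) => A; rewrite !mxE !eqxx mulr1.
rewrite big_split/= -scalarE sumr_const card_ord mulNrn -[_ *+ n]mulr_natr.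
by rewrite divfK// subrr.
Qed.

Lemma sum_R4 a b :
  \sum_i R4 g x a (e i) (e' i) b
  = inner g x (P a) b + scalar_curv g x / n%:R * inner g x a b.
Proof.
rewrite trless_inner subrK (ricci_R4 gs Ox); apply: eq_bigr => i _.
by rewrite (R4_swap12 g x a) (R4_swap34 gs _ _ _ _ Ox) opprK.
Qed.

End Contractions.

(** * Transfer between pairs and coordinate vectors of the warped product *)

Section Bridge.
Context (R : realType) (p : nat) (p2 : (2 < p)%N) (eps : R) (heps : eps = 1 \/ eps = -1).
Context (O1 : set 'rV[R]_1) (gb : 'rV[R]_1 -> 'M[R]_1)
  (gbs : smooth_metric O1 gb) (gbE : forall t, O1 t -> gb t 0 0 = eps).
Context (f : 'rV[R]_1 -> R) (fs : smooth_on O1 f) (f_gt0 : forall t, O1 t -> 0 < f t).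
Context (O2 : set 'rV[R]_p) (h : 'rV[R]_p -> 'M[R]_p) (hs : smooth_metric O2 h).
Context (x : 'rV[R]_(1 + p)) (x1 : O1 (lsubmx x)) (x2 : O2 (rsubmx x)).

Local Notation g := (warp gb f h).
Local Notation y := (rsubmx x).
Local Notation F := (f (lsubmx x)).
Local Notation w := (wacc f (lsubmx x)).
Local Notation v := (wsq f (lsubmx x)).
Local Notation H := (inner h y).
Local Notation P := (trless h y).
Local Notation kq := (scalar_curv h y / p%:R).

Let W := 'rV[R]_p.
Definition of_pair (U : R * W) : 'rV[R]_(1 + p) := vec U.1 U.2.
Local Notation Phi := of_pair.

Local Notation pcurv := (@pair_curv R W H (curv h y) eps w v F).
Local Notation pweyl := (@pair_weyl R W H (curv h y) P eps F p%:R kq).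
Local Notation pR := (@pair_R R W H (curv h y) eps w v F).
Local Notation pC := (@pair_C R W H (curv h y) P eps F p%:R kq).
Local Notation pricci := (@pair_ricci R W H P eps w v F p%:R kq).
Local Notation pwedge := (@pair_wedgeS R W H P eps w v F p%:R kq).
Local Notation plhs := (@pair_lhs R W H (curv h y) P eps w v F p%:R kq).
Local Notation pQSR := (@pair_QSR R W H (curv h y) P eps w v F p%:R kq).

Let curv_pair U V Z : curv g x (Phi U) (Phi V) (Phi Z) = Phi (pcurv U V Z).
Proof. exact: (curv_vec heps gbs gbE fs f_gt0 hs x1 x2). Qed.

Let weyl_pair U V Z : weyl_op g x (Phi U) (Phi V) (Phi Z) = Phi (pweyl U V Z).
Proof. exact: (weyl_vec heps gbs gbE fs f_gt0 hs x1 x2 _ _ _ _ _ _ p2). Qed.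

Let inner_pair U V : inner g x (Phi U) (Phi V) = pair_inner H eps F U V.
Proof. exact: (inner_vec gbE). Qed.

Let ricci_pair U V : ricci g x (Phi U) (Phi V) = pricci U V.
Proof.
apply: etrans (ricci_vec heps gbs gbE fs f_gt0 hs x1 x2 _ _ _ _) _.
rewrite /pair_ricci (trless_inner hs x2).
by move: (inner h y U.2 V.2) (ricci h y U.2 V.2) => A r; ring.
Qed.

Let wedge_pair U V Z : wedge_op (ricci g x) (Phi U) (Phi V) (Phi Z) = Phi (pwedge U V Z).
Proof. by rewrite /wedge_op !ricci_pair /of_pair !vecZ vecB. Qed.

Let R4_pairs U V Z T : R4 g x (Phi U) (Phi V) (Phi Z) (Phi T) = pR U V Z T.
Proof. by rewrite /R4 curv_pair inner_pair. Qed.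

Let C4_pairs U V Z T : C4 g x (Phi U) (Phi V) (Phi Z) (Phi T) = pC U V Z T.
Proof. by rewrite /C4 weyl_pair inner_pair. Qed.

Lemma QT_pairs U1 U2 U3 U4 U V :
  QT (ricci g x) (R4 g x) (Phi U1) (Phi U2) (Phi U3) (Phi U4) (Phi U) (Phi V)
  = pQSR U1 U2 U3 U4 U V.
Proof. by rewrite /QT /endo_act !wedge_pair !R4_pairs. Qed.

Lemma lhs_pairs U1 U2 U3 U4 U V :
  dotT (curv g x) (C4 g x) (Phi U1) (Phi U2) (Phi U3) (Phi U4) (Phi U) (Phi V)
  - dotT (weyl_op g x) (R4 g x) (Phi U1) (Phi U2) (Phi U3) (Phi U4) (Phi U) (Phi V)
  = plhs U1 U2 U3 U4 U V.
Proof. by rewrite /dotT /endo_act !curv_pair !weyl_pair !R4_pairs !C4_pairs. Qed.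

Let hT : (h y)^T = h y. Proof. by case: hs => _ _ + _; apply. Qed.
Let hU : h y \in unitmx. Proof. by case: hs => _ _ _; apply. Qed.

Let HP1 k a a' b : H (k *: a + a') b = k * H a b + H a' b.
Proof. by rewrite innerDl innerZl. Qed.
Let HC a b : H a b = H b a. Proof. exact: innerC. Qed.
Let H0 b : H 0 b = 0. Proof. by rewrite -(scale0r 0) innerZl mul0r. Qed.
Let BP1 k a a' b c d : R4 h y (k *: a + a') b c d = k * R4 h y a b c d + R4 h y a' b c d.
Proof. by rewrite (R4D1 hs x2) (R4Z1 hs x2). Qed.
Let B12 a b c d : R4 h y a b c d = - R4 h y b a c d. Proof. exact: R4_swap12. Qed.
Let B34 a b c d : R4 h y a b c d = - R4 h y a b d c. Proof. exact: (R4_swap34 hs). Qed.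
Let Bpair a b c d : R4 h y a b c d = R4 h y c d a b. Proof. exact: (R4_pair hs). Qed.
Let PP k a b : P (k *: a + b) = k *: P a + P b. Proof. exact: (trlessP hs x2). Qed.
Let Psym a b : H (P a) b = H a (P b). Proof. exact: (trless_sym hs x2). Qed.
Let Rt01 b c : curv h y 0 b c = 0.
Proof. by apply: (inner_inj hU) => z; rewrite H0; exact: (R4_01 hs x2). Qed.
Let Rt03 a b : curv h y a b 0 = 0.
Proof. by apply: (inner_inj hU) => z; rewrite H0; exact: (R4_03 hs x2). Qed.

Let F0 : F != 0. Proof. by rewrite gt_eqF// f_gt0. Qed.
Let q0 : p%:R != 0 :> R. Proof. by rewrite pnatr_eq0; case: (p) p2. Qed.
Let q1 : p%:R - 1 != 0 :> R.
Proof. by rewrite subr_eq0 (eqr_nat R p 1); case: (p) p2 => [|[]]. Qed.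

Local Notation QHP := (@QHP R W H P).

(** By this trace, Q(H,P) cannot vanish identically where [P] is nonzero. *)
Lemma sum_QHP Y V : \sum_i QHP Y (dual h y i) (delta_mx 0 i) V = p%:R * H (P Y) V.
Proof.
rewrite /QHP /GH; transitivity (\sum_(i < p) (H Y (delta_mx 0 i) * H (dual h y i) (P V)
   - H (P (delta_mx 0 i)) (dual h y i) * H Y V
   + H (delta_mx 0 i) (dual h y i) * H (P Y) V
   - H (P Y) (delta_mx 0 i) * H (dual h y i) V)).
  apply: eq_bigr => i _.
  rewrite (Psym (dual h y i) V) (Psym (dual h y i)).
  rewrite (HC (dual h y i) (P (delta_mx 0 i))) (HC (dual h y i) (delta_mx 0 i)).
  by rewrite !addrA.
rewrite !(big_split, sumrN)/= -!mulr_suml !(sum_inner_dual hs x2).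
rewrite (sum_trless hs x2 q0) (sum_inner hs x2) (Psym Y) mul0r subr0.
by rewrite addrAC subrr add0r.
Qed.

Section ConditionAtPoint.
Context (L0 : R)
  (cond : (exists u1 u2 u3 u4 u v, QT (ricci g x) (R4 g x) u1 u2 u3 u4 u v != 0) ->
    forall u1 u2 u3 u4 u v,
      dotT (curv g x) (C4 g x) u1 u2 u3 u4 u v
      - dotT (weyl_op g x) (R4 g x) u1 u2 u3 u4 u v
      = L0 * QT (ricci g x) (R4 g x) u1 u2 u3 u4 u v).

(** [cond] becomes available only once a nonzero component of Q(S,R) is exhibited; a nonzero summand
    of the trace in [sum_QHP] supplies it. *)
Lemma trless_quadratic : w != 0 -> (exists a, P a != 0) -> forall V X,
  H (P (P V)) X + (kq + eps * (p%:R * w - (p%:R - 1) * v)) * H (P V) X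
  + (eps * w * kq + (p%:R - 1) * (w * (w - v))) * H V X = 0.
Proof.
move=> w0 [a Pa] V X.
have [b Hb] : exists b, H (P a) b != 0.
  apply: contrapT => /forallNP H0'; move/eqP: Pa; apply; apply: (inner_inj hU) => z.
  by rewrite H0; apply/eqP/negPn/negP; exact: H0'.
have [i Qi] : exists i, QHP a (dual h y i) (delta_mx 0 i) b != 0.
  apply: contrapT => /forallNP Q0'; move/eqP: (mulf_neq0 q0 Hb); apply.
  by rewrite -sum_QHP big1// => i _; apply/eqP/negPn/negP; exact: Q0'.
have ex : exists u1 u2 u3 u4 u v, QT (ricci g x) (R4 g x) u1 u2 u3 u4 u v != 0.
  exists (Phi (1, 0)), (Phi (0, a)), (Phi (0, dual h y i)), (Phi (1, 0)).
  exists (Phi (0, delta_mx 0 i)), (Phi (0, b)); rewrite QT_pairs.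
  rewrite (pair_QSR_TYZT HP1 HC BP1 Psym heps w v _ _ F0).
  exact: mulf_neq0.
have pc U1 U2 U3 U4 U' V' : plhs U1 U2 U3 U4 U' V' = L0 * pQSR U1 U2 U3 U4 U' V'.
  by rewrite -lhs_pairs -QT_pairs; exact: (cond ex).
have Lq := condition_value HP1 HC BP1 B12 B34 Bpair PP Psym Rt01 Rt03 heps F0 q1 pc w0 Qi.
have nul Y Z := condition_null HP1 HC BP1 PP Rt01 heps F0 q1 pc V Y Z X Lq.
(* Contraction of the middle slots: G~ yields p - 1 times the metric, and the curvature yields the
   Ricci tensor. *)
have sG c : \sum_i GH H c (delta_mx 0 i) (dual h y i) X = (p%:R - 1) * H c X.
  rewrite /GH sumrB -mulr_suml (sum_inner hs x2).
  under [X in _ - X]eq_bigr do rewrite mulrC.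
  by rewrite (sum_dual_inner hs x2) mulrBl mul1r.
have sB c : \sum_i BH H (curv h y) c (delta_mx 0 i) (dual h y i) X = H (P c) X + kq * H c X.
  exact: (sum_R4 hs x2 c X).
have e := @big1 R 0 (@GRing.add R) _ (index_enum 'I_p) xpredT _
  (fun j _ => nul (delta_mx 0 j) (dual h y j)).
rewrite !big_split/= -!mulr_sumr in e; apply: etrans e.
transitivity (H (P (P V)) X + kq * H (P V) X + eps * w * (H (P V) X + kq * H V X)
  + eps * (w - v) * ((p%:R - 1) * H (P V) X) + w * (w - v) * ((p%:R - 1) * H V X)).
  generalize_atoms; move: w v kq (p%:R : R) => *; ring.
congr (_ + _ * _ + _ * _ + _ * _); apply: esym;
  [exact: sB|exact: sB|exact: sG|exact: sG].
Qed.

(** For [w = 0] the right side of [condition_TYZX] vanishes. This is the identity for the curvature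
    of the fiber, which in turn makes [condition_XXXX] applicable. *)
Lemma flat_condition : w = 0 ->
  (exists u1 u2 u3 u4 u v, QT (ricci g x) (R4 g x) u1 u2 u3 u4 u v != 0) ->
  L0 = (p%:R - 1)^-1 /\
  forall X Y Z T, R4 h y (P X) Y Z T = eps * v * GH H (P X) Y Z T.
Proof.
move=> w0 ex.
have pc U1 U2 U3 U4 U' V' : plhs U1 U2 U3 U4 U' V' = L0 * pQSR U1 U2 U3 U4 U' V'.
  by rewrite -lhs_pairs -QT_pairs; exact: (cond ex).
have PB X Y Z T : R4 h y (P X) Y Z T = eps * v * GH H (P X) Y Z T.
  have e := condition_TYZX HP1 HC BP1 PP Rt01 heps F0 q1
    (pc (1, 0) (0, Y) (0, Z) (0, T) (1, 0) (0, X)).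
  by rewrite w0 !(mulr0, mul0r, addr0) in e; exact: subr0_eq e.
split=> //; move: ex => [u1 [u2 [u3 [u4 [u [v' Q0]]]]]].
pose r (c : 'rV[R]_(1 + p)) : R * W := (0, rsubmx c).
(* The arguments of the given nonzero component may have base parts; dropping them does not change
   its value. *)
have Qr : pQSR (r u1) (r u2) (r u3) (r u4) (r u) (r v') != 0.
  apply: contra_neq Q0 => Qr0.
  have E c : c = Phi (lsubmx c 0 0, rsubmx c) by exact: vec_eta.
  rewrite (E u1) (E u2) (E u3) (E u4) (E u) (E v') QT_pairs.
  apply: etrans Qr0.
  exact: (@pair_QSR_flat _ _ _ _ _ HP1 _ heps _ _ _ _ _ F0 (_, _) (_, _) (_, _) (_, _) (_, _) (_, _) w0).
have e := condition_XXXX HP1 HC BP1 B12 B34 Bpair PP Psym heps kq F0 q1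
  (rsubmx u1) (rsubmx u2) (rsubmx u3) (rsubmx u4) (rsubmx u) (rsubmx v') w0 PB.
by apply: (mulIf Qr); rewrite -pc e.
Qed.

End ConditionAtPoint.

End Bridge.

(** * The warping function *)

Section WarpingFunction.
Context (R : realType) (O : set 'rV[R]_1) (oO : open O) (f : 'rV[R]_1 -> R)
  (fs : smooth_on O f) (f_gt0 : forall t, O t -> 0 < f t).
Implicit Type t : 'rV[R]_1.

Local Notation D := (delta_mx 0 0 : 'rV[R]_1).

Let dfs : smooth_on O (df f). Proof. exact: smooth_on_derive. Qed.
Let ddfs : smooth_on O (ddf f). Proof. exact: smooth_on_derive. Qed.

Let f0 t : O t -> f t != 0. Proof. by move=> Ot; rewrite gt_eqF// f_gt0. Qed.

Lemma wacc_continuous t : O t -> {for t, continuous (wacc f)}.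
Proof.
move=> Ot.
have cf := smooth_on_continuous fs Ot.
have cdf := smooth_on_continuous dfs Ot.
have cddf := smooth_on_continuous ddfs Ot.
apply: (@continuousB _ _ _ (fun t => ddf f t / 2) (fun t => df f t ^+ 2 / (4 * f t))).
  by apply: (@continuousM _ _ (ddf f) (cst 2^-1)) => //; exact: cst_continuous.
apply: (@continuousM _ _ (fun t => df f t * df f t) (fun t => (4 * f t)^-1)).
  exact: (@continuousM _ _ (df f) (df f)).
apply: (@continuousV _ _ (fun t => 4 * f t)); first by rewrite mulf_neq0// ?pnatr_eq0// f0.
by apply: (@continuousM _ _ (cst 4) f) => //; exact: cst_continuous.
Qed.

(** The hypothesis states that the two coefficients of the quadratic equation for P agree at [t] and
    [t0]. It is used near [t0], where w stays nonzero by continuity. *)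
Lemma wacc_eq0 (eps q k : R) t0 : eps = 1 \/ eps = -1 -> q - 1 != 0 -> O t0 ->
  (forall t, O t -> wacc f t != 0 ->
     k + eps * (q * wacc f t - (q - 1) * wsq f t)
       = k + eps * (q * wacc f t0 - (q - 1) * wsq f t0)
     /\ eps * wacc f t * k + (q - 1) * (wacc f t * (wacc f t - wsq f t))
       = eps * wacc f t0 * k + (q - 1) * (wacc f t0 * (wacc f t0 - wsq f t0))) ->
  wacc f t0 = 0.
Proof.
move=> heps q1 Ot0 H; apply/eqP/negPn/negP => w0.
have cw := wacc_continuous Ot0.
(* Eliminating v from the two equations leaves a quadratic equation for [wacc f t] with roots
   [wacc f t0] and [m - wacc f t0]. *)
pose m := eps * k - (q - 1) * wsq f t0 + q * wacc f t0.
have nO : \forall t \near t0, O t by exact: open_nbhs_nbhs.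
have nw : \forall t \near t0, wacc f t != 0 by exact: (cvgr_neq0 _ cw).
have key t : O t -> wacc f t != 0 -> (q - 1) * (wsq f t - wsq f t0) = q * (wacc f t - wacc f t0)
    /\ (wacc f t - wacc f t0) * (m - wacc f t - wacc f t0) = 0.
  move=> Ot wt; have [e1 e2] := H t Ot wt.
  have e3 : (q - 1) * (wsq f t - wsq f t0) = q * (wacc f t - wacc f t0).
    by apply: (eq_combination (k := - eps) e1); case: heps => ->; ring.
  split=> //.
  have e4 : wacc f t * ((q - 1) * wsq f t)
      = wacc f t * ((q - 1) * wsq f t0 + q * (wacc f t - wacc f t0)).
    by rewrite -e3; ring.
  have e5 : eps * wacc f t * k + (q - 1) * wacc f t ^+ 2 - wacc f t * ((q - 1) * wsq f t)
      = eps * wacc f t0 * k + (q - 1) * (wacc f t0 * (wacc f t0 - wsq f t0)).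
    by rewrite -e2; ring.
  rewrite e4 in e5; apply: (eq_combination (k := 1) e5); rewrite /m; ring.
have nweq : \forall t \near t0, wacc f t = wacc f t0.
  (* If the two roots coincide nothing is left to exclude; otherwise continuity keeps w away from
     the second root near [t0]. *)
  have [m0|m0] := eqVneq (m - wacc f t0 - wacc f t0) 0.
    near=> t; have Ot : O t by near: t; exact: nO.
    have wt : wacc f t != 0 by near: t; exact: nw.
    have [_ /eqP] := key t Ot wt.
    have -> : m - wacc f t - wacc f t0 = - (wacc f t - wacc f t0).
      by apply: (eq_combination (k := 1) m0); ring.
    by rewrite mulf_eq0 oppr_eq0 orbb subr_eq0 => /eqP.
  have cm : {for t0, continuous (fun t => m - wacc f t - wacc f t0)}.
    apply: (@continuousB _ _ _ (fun t => m - wacc f t) (cst (wacc f t0))); last first.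
      exact: cst_continuous.
    by apply: (@continuousB _ _ _ (cst m) (wacc f)) => //; exact: cst_continuous.
  have nm : \forall t \near t0, m - wacc f t - wacc f t0 != 0 by exact: (cvgr_neq0 _ cm m0).
  near=> t; have Ot : O t by near: t; exact: nO.
  have wt : wacc f t != 0 by near: t; exact: nw.
  have mt : m - wacc f t - wacc f t0 != 0 by near: t; exact: nm.
  have [_ /eqP] := key t Ot wt.
  by rewrite mulf_eq0 (negPf mt) orbF subr_eq0 => /eqP.
(* Now v is constant as well: f'^2 = 4 v f near [t0], an equation that can be differentiated. *)
have nv : \forall t \near t0, df f t * df f t = 4 * wsq f t0 * f t.
  near=> t; have Ot : O t by near: t; exact: nO.
  have wt : wacc f t != 0 by near: t; exact: nw.
  have wE : wacc f t = wacc f t0 by near: t; exact: nweq.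
  have [+ _] := key t Ot wt; rewrite wE subrr mulr0 => /eqP.
  rewrite mulf_eq0 (negPf q1)/= subr_eq0 => /eqP <-.
  by rewrite /wsq; field; exact: f0.
have d0 := @smooth_on_derivable _ _ _ _ 0 _ fs Ot0.
have d1 := @smooth_on_derivable _ _ _ _ 0 _ dfs Ot0.
have eD := near_eq_derive D nv.
rewrite (derive_mulfun d1 d1) (derive_cmul _ d0) -/(ddf f t0) -/(df f t0) in eD.
(* If f' were nonzero, 2 f' f'' = 4 v f' would give f'' = 2 v, which means w = 0. *)
have df0 : df f t0 = 0.
  apply/eqP; move/eqP: w0; apply: contra_notT => df0; apply: (mulfI df0).
  apply: (eq_combination (k := 1 / 4) eD).
  by rewrite /wacc -/(wsq f t0); field.
have v0 : wsq f t0 = 0 by rewrite /wsq df0 expr0n mul0r.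
(* With v = 0 the equation forces f' = 0 on a neighborhood of [t0]. *)
have dd0 : ddf f t0 = 0.
  rewrite /ddf (@near_eq_derive _ _ _ (df f) (cst 0)) ?derive_cst//.
  by apply: filterS nv => t; rewrite v0 mulr0 mul0r => /eqP; rewrite mulf_eq0 orbb => /eqP.
by move: w0; rewrite /wacc -/(wsq f t0) v0 dd0 mul0r subrr eqxx.
Unshelve. all: by end_near. Qed.

Context (cO : connected O).

Lemma interval_const (I : set R) (g : R -> R) : is_interval I ->
  (forall s, I s -> is_derive s 1 g 0) -> forall s s', I s -> I s' -> g s = g s'.
Proof.
move=> iI gd.
suff H s s' : s <= s' -> I s -> I s' -> g s = g s'.
  by move=> s s' Is Is'; have [ss'|/ltW ss'] := leP s s'; [exact: H|exact: esym (H _ _ _ _ _)].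
move=> ss' Is Is'.
have Icc u : u \in `[s, s']%R -> I u.
  by rewrite in_itv/= => /andP[su us']; apply: (iI s s' Is Is'); rewrite su us'.
have [||c _ e] := @MVT_segment R g (fun=> 0) s s' ss'.
- by move=> u us; apply: gd; apply: Icc; exact: subset_itv_oo_cc.
- by apply: derivable_within_continuous => u /Icc /gd [].
by move: e; rewrite mul0r => /eqP; rewrite subr_eq0 => /eqP.
Qed.

(** Vanishing of w means 2 f f'' = f'^2. Differentiating gives f''' = 0, so f is a polynomial of
    degree at most 2 with zero discriminant, hence a square. Connectedness makes the integration
    constants global. *)
Lemma warping_square : (forall t, O t -> wacc f t = 0) ->
  exists a b : R, forall t, O t -> f t = (a * t 0 0 + b) ^+ 2 /\ wsq f t = a ^+ 2.
Proof.
move=> w0; have [[t0 Ot0]|nO] := pselect (exists t, O t); last first.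
  by exists 0, 0 => t Ot; case: nO; exists t.
(* The summand 0 gives the points the shape required by [is_derive_line], with base point 0. *)
have tE t : t = t 0 0 *: D + 0.
  by rewrite addr0; apply/rowP => i; rewrite !ord1 !mxE !eqxx mulr1.
pose I : set R := [set s | O (s *: D + 0)].
have iI : is_interval I.
  apply/connected_intervalP.
  have -> : I = (fun t => t 0 0) @` O.
    apply/seteqP; split => [s Is|s [t Ot <-]]; last by rewrite /I/= -tE.
    by exists (s *: D + 0) => //; rewrite addr0 !mxE !eqxx mulr1.
  apply: connected_continuous_connected => //.
  by apply: continuous_subspaceT => t; exact: coord_continuous.
have dI (G : 'rV[R]_1 -> R) s : smooth_on O G -> I s ->
    is_derive s 1 (fun s : R => G (s *: D + 0)) ('D_D G (s *: D + 0)).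
  by move=> Gs Is; apply: is_derive_line; exact: (@smooth_on_derivable _ _ _ _ 0 _ Gs Is).
have E t : O t -> 2 * (f t * ddf f t) = df f t * df f t.
  move=> Ot; have := w0 t Ot; rewrite /wacc => e.
  by apply: (eq_combination (k := 4 * f t) e); field; exact: f0.
have d3 t : O t -> 'D_D (ddf f) t = 0.
  move=> Ot.
  have e : 'D_D (fun t => 2 * (f t * ddf f t)) t = 'D_D (fun t => df f t * df f t) t.
    by apply: near_eq_derive; apply: (near_open oO Ot) => u Ou; exact: E.
  have d0 := @smooth_on_derivable _ _ _ _ 0 _ fs Ot; have d1 := @smooth_on_derivable _ _ _ _ 0 _ dfs Ot.
  have d2 := @smooth_on_derivable _ _ _ _ 0 _ ddfs Ot.
  rewrite (derive_cmul _ (derivable_mulfun d0 d2)) (derive_mulfun d0 d2) in e.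
  rewrite (derive_mulfun d1 d1) in e.
  have e' : 2 * f t * 'D_D (ddf f) t = 0.
    rewrite -/(df f t) -/(ddf f t) in e; move: ('D_D (ddf f) t) e => x e.
    by apply: (eq_combination (k := 1) e); ring.
  by move/eqP: e'; rewrite !mulf_eq0 (negPf (f0 Ot)) pnatr_eq0/= => /eqP.
pose s0 := t0 0 0; have Is0 : I s0 by rewrite /I/= -tE.
pose c := ddf f t0; pose b1 := df f t0.
have ddfE s : I s -> ddf f (s *: D + 0) = c.
  move=> Is; have := interval_const (g := fun s => ddf f (s *: D + 0)) iI _ Is Is0.
  rewrite -tE; apply => u Iu; have := dI _ _ ddfs Iu; rewrite d3//.
have dfE s : I s -> df f (s *: D + 0) = b1 + c * (s - s0).
  move=> Is; have := interval_const (g := fun s => df f (s *: D + 0) - c * s) iI _ Is Is0.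
  rewrite -tE => e; have {}e : df f (s *: D + 0) - c * s = b1 - c * s0.
    apply: e => u Iu; have h1 := dI _ _ dfs Iu; rewrite -/(ddf f _) ddfE// in h1.
    have h2 : is_derive u 1 (fun s : R => c * s) c.
      by apply: is_derive_eq; rewrite [_ *: _]mulr1.
    by apply: is_derive_eq; rewrite subrr.
  by apply: (eq_combination (k := 1) e); ring.
have fE s : I s -> f (s *: D + 0) = f t0 + b1 * (s - s0) + c / 2 * (s - s0) ^+ 2.
  move=> Is; pose pol (s : R) := b1 * (s - s0) + c / 2 * (s - s0) ^+ 2.
  have := interval_const (g := fun s => f (s *: D + 0) - pol s) iI _ Is Is0.
  rewrite -tE => e; have {}e : f (s *: D + 0) - pol s = f t0 - pol s0.
    apply: e => u Iu; have h1 := dI _ _ fs Iu; rewrite -/(df f _) dfE// in h1.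
    have h2 : is_derive u 1 pol (b1 + c * (u - s0)).
      rewrite /pol; apply: is_derive_eq; rewrite /GRing.scale/=.
      by field.
    by apply: is_derive_eq; rewrite subrr.
  by apply: (eq_combination (k := 1) e); rewrite /pol; ring.
pose r := Num.sqrt (f t0).
have r0 : r != 0 by rewrite gt_eqF// sqrtr_gt0 f_gt0.
have r2 : r ^+ 2 = f t0 by rewrite sqr_sqrtr// ltW// f_gt0.
(* This is 2 f f'' = f'^2 at [t0], the vanishing of the discriminant. *)
have cE : c = b1 ^+ 2 / (2 * r ^+ 2).
  rewrite r2; have := E t0 Ot0; rewrite -/c -/b1 => e.
  by apply: (eq_combination (k := (2 * f t0)^-1) e); field; exact: f0.
(* The root of f is the affine function with value [r] and slope f' / (2 r) at [s0]. *)
exists (b1 / (2 * r)), (r - b1 / (2 * r) * s0) => t Ot.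
have It : I (t 0 0) by rewrite /I/= -tE.
split.
  by rewrite {1}(tE t) fE// -r2 cE; field.
have -> : wsq f t = c / 2.
  have := w0 t Ot; rewrite /wacc -/(wsq f t) => /eqP; rewrite subr_eq0 => /eqP <-.
  by rewrite (tE t) ddfE.
by rewrite cE; field.
Qed.

End WarpingFunction.

(** * The theorem *)

Section TracelessPart.
Context (R : realType) (n : nat) (n0 : n%:R != 0 :> R) (O : set 'rV[R]_n)
  (g : 'rV[R]_n -> 'M[R]_n) (gs : smooth_metric O g) (x : 'rV[R]_n) (Ox : O x).

Local Notation H := (inner g x).
Local Notation P := (trless g x).

Let gU : g x \in unitmx. Proof. by case: gs => _ _ _; apply. Qed.
Let gT : (g x)^T = g x. Proof. by case: gs => _ _ + _; apply. Qed.

Lemma trless_neq0 : ~ einstein_at g x -> exists a, P a != 0.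
Proof.
move=> nE; apply: contrapT => /forallNP P0; apply: nE => u v.
have /eqP Pu : P u == 0 by apply/negPn/negP; exact: P0.
apply/eqP; rewrite -subr_eq0 -(trless_inner gs Ox) Pu.
by rewrite -(scale0r 0) innerZl mul0r.
Qed.

(** [P] and the identity are linearly independent: the trace eliminates [P] and yields [B = 0]. *)
Lemma trless_free (A B : R) : (exists a, P a != 0) ->
  (forall u v, A * H (P u) v + B * H u v = 0) -> A = 0 /\ B = 0.
Proof.
move=> [a Pa] AB.
have B0 : B = 0.
  have := @big1 R 0 (@GRing.add R) _ (index_enum 'I_n) xpredT _
    (fun j _ => AB (delta_mx 0 j) (dual g x j)).
  rewrite !big_split/= -!mulr_sumr (sum_trless gs Ox n0) (sum_inner gs Ox) mulr0 add0r.
  by move=> /eqP; rewrite mulf_eq0 (negPf n0) orbF => /eqP.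
split=> //; apply/eqP/negPn/negP => A0; move/eqP: Pa; apply; apply: (inner_inj gU) => v.
rewrite -[in RHS](scale0r 0) innerZl mul0r; apply: (mulfI A0).
by rewrite mulr0 -(AB a v) B0 mul0r addr0.
Qed.

Lemma sum_S_mixed i (f : 'rV[R]_n -> R) :
  (forall u u' a, f (a *: u + u') = a * f u + f u') ->
  \sum_e S_mixed g x i e * f (delta_mx 0 e) = f (ricci_op g x (delta_mx 0 i)).
Proof.
move=> fP; rewrite (linear_rV_sum _ fP); apply: eq_bigr => e _; congr (_ * _).
rewrite /ricci_op mxE /S_mixed; apply: eq_bigr => k _.
rewrite [in RHS]mxE mulrC; congr (_ * _).
by rewrite -[in LHS]gT -trmx_inv mxE.
Qed.

Lemma inner_delta i j : H (delta_mx 0 i) (delta_mx 0 j) = g x i j.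
Proof. by rewrite inner_mx trmx_delta -rowE -colE !mxE. Qed.

(** The Ricci operator is [P] plus a multiple of the identity. The hypothesis treats the first
    summand; writing [P] back through the Ricci tensor produces the term with G. *)
Lemma fiber_identity (k : R) :
  (forall u v w z, R4 g x (P u) v w z = k * GH H (P u) v w z) ->
  forall mu be ga de : 'I_n,
    \sum_e S_mixed g x mu e * R_comp g x e be ga de
    = scalar_curv g x / n%:R * R_comp g x mu be ga de
      + k * (g_comp g x be ga * S_comp g x mu de - g_comp g x be de * S_comp g x mu ga)
      - k * scalar_curv g x / n%:R * G_comp g x mu be ga de.
Proof.
move=> PB mu be ga de.
pose e (i : 'I_n) : 'rV[R]_n := delta_mx 0 i.
rewrite (@sum_S_mixed mu (fun u => R4 g x u (e be) (e ga) (e de))); last first.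
  by move=> u u' a; rewrite (R4D1 gs Ox) (R4Z1 gs Ox).
have -> : ricci_op g x (delta_mx 0 mu) = P (e mu) + (scalar_curv g x / n%:R) *: e mu.
  by rewrite /trless subrK.
rewrite (R4D1 gs Ox) (R4Z1 gs Ox) PB /GH.
rewrite (trless_inner gs Ox (e mu) (e de)) (trless_inner gs Ox (e mu) (e ga)).
rewrite /g_comp -!inner_delta -/(e be) -/(e ga) -/(e de).
have -> : G_comp g x mu be ga de
   = H (e be) (e ga) * H (e mu) (e de) - H (e mu) (e ga) * H (e be) (e de).
  by rewrite /G_comp /G4 /wedge_op innerDl innerNl !innerZl.
rewrite -/(R_comp g x mu be ga de) -/(S_comp g x mu de) -/(S_comp g x mu ga).
move: (R_comp _ _ _ _ _ _) (S_comp _ _ _ _) (S_comp _ _ _ _) (scalar_curv _ _).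
by generalize_atoms => *; field.
Qed.

End TracelessPart.

Lemma chart_smooth_metric (R : realType) m (M : semiRiemannian R m) (c : chart R M m) :
  atlas c -> smooth_metric (chart_img c) (metric c).
Proof.
move=> ac; split; [exact: chart_img_open|exact: metric_smooth| |].
- by move=> u cu; exact: (Defs.metric_sym ac cu).
- by move=> u cu; exact: (Defs.metric_nondegenerate ac cu).
Qed.

Lemma connected_chart_img (R : realType) m (T : topologicalType) (c : chart R T m) :
  connected (chart_dom c) -> connected (chart_img c).
Proof.
move=> cc; apply: connected_continuous_connected cc _.
exact: continuous_in_subspaceT (@chart_coord_continuous _ _ _ c).
Qed.

(** [a] and [b] belong to the coordinate of the base chart [c]. Connectedness of its domain provides
    one pair for the whole chart, chosen before the fiber chart [d] and the point [z]. *)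
Theorem theorem4p1 (R : realType) (n : nat) (hn : (4 <= n)%N)
    (eps : R) (heps : eps = 1 \/ eps = -1)
    (M : semiRiemannian R 1)
    (hM : forall p : M, exists c : chart R M 1,
       [/\ atlas c, chart_dom c p & unit_coord eps c])
    (N : semiRiemannian R n.-1) (hN : ~ einstein N)
    (F : M -> R) (F_gt0 : forall p, 0 < F p) (F_smooth : smooth_fun F)
    (L : M * N -> R) (hL : curvature_condition F L) :
  forall c : chart R M 1,
    atlas c -> connected (chart_dom c) -> unit_coord eps c ->
  exists a b : R,
    forall d : chart R N n.-1, atlas d ->
    forall z : M * N, (U_QSR F c d `&` U_S F c d `&` U_C F c d) z ->
    let gt := metric d in
    let y := chart_coord d z.2 in
    [/\ L z = 1 / (n%:R - 2),
        F z.1 = (a * chart_coord c z.1 0 0 + b) ^+ 2 &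
        forall mu be ga de : 'I_n.-1,
          \sum_e S_mixed gt y mu e * R_comp gt y e be ga de
          = scalar_curv gt y / (n%:R - 1) * R_comp gt y mu be ga de
            + eps * a ^+ 2 * (g_comp gt y be ga * S_comp gt y mu de
                              - g_comp gt y be de * S_comp gt y mu ga)
            - eps * scalar_curv gt y * a ^+ 2 / (n%:R - 1)
              * G_comp gt y mu be ga de].
Proof.
move=> c ac cc uc.
have p2 : (2 < n.-1)%N by move: hn; clear; case: n => [//|m].
have nE : n%:R = n.-1%:R + 1 :> R by rewrite natr1 prednK//; apply: leq_trans hn.
have p0 : n.-1%:R != 0 :> R by rewrite pnatr_eq0; case: n.-1 p2.
have p1 : n.-1%:R - 1 != 0 :> R.
  by rewrite subr_eq0 (eqr_nat R n.-1 1); case: n.-1 p2 => [|[]].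
pose f := F \o chart_param c.
have fs : smooth_on (chart_img c) f by exact: F_smooth.
have f_gt0 t : chart_img c t -> 0 < f t by move=> _; exact: F_gt0.
have gbs := chart_smooth_metric ac; have oI := @chart_img_open _ _ _ c.
have gbE t : chart_img c t -> metric c t 0 0 = eps by move=> [P cP <-]; exact: uc.
have w0 t : chart_img c t -> wacc f t = 0.
  (* One point at which the fiber is not Einstein serves all base points of the chart. *)
  have [d [P0 [ad dP0 nE0]]] : exists (d : chart R N n.-1) (P0 : N), [/\ atlas d, chart_dom d P0 &
      ~ einstein_at (metric d) (chart_coord d P0)].
    apply: contrapT => H; apply: hN => d P0 ad dP0; apply: contrapT => nE0.
    by apply: H; exists d, P0; split.
  have hs := chart_smooth_metric ad.
  pose y := chart_coord d P0.
  have Oy : chart_img d y by exists P0.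
  have Pn := trless_neq0 hs Oy nE0.
  have Q t' : chart_img c t' -> wacc f t' != 0 -> forall V X,
      inner (metric d) y (trless (metric d) y (trless (metric d) y V)) X
      + (scalar_curv (metric d) y / n.-1%:R
         + eps * (n.-1%:R * wacc f t' - (n.-1%:R - 1) * wsq f t'))
        * inner (metric d) y (trless (metric d) y V) X
      + (eps * wacc f t' * (scalar_curv (metric d) y / n.-1%:R)
         + (n.-1%:R - 1) * (wacc f t' * (wacc f t' - wsq f t')))
        * inner (metric d) y V X = 0.
    move=> Ot' wt' V X; have [P cP PE] := Ot'.
    pose x := prod_coord c d (P, P0).
    have xl : lsubmx x = t' by rewrite row_mxKl.
    have xr : rsubmx x = y by rewrite row_mxKr.
    have x1 : chart_img c (lsubmx x) by rewrite xl.
    have x2 : chart_img d (rsubmx x) by rewrite xr.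
    have cond : (exists u1 u2 u3 u4 u v,
        QT (ricci (warp (metric c) f (metric d)) x) (R4 (warp (metric c) f (metric d)) x)
           u1 u2 u3 u4 u v != 0) -> _
      := fun ex => hL c d ac ad (P, P0) (conj (conj cP dP0) ex).
    have := trless_quadratic p2 heps gbs gbE fs f_gt0 hs x1 x2 cond.
    rewrite xl xr => /(_ wt' Pn V X); exact.
  move=> Ot; have [//|wt] := eqVneq (wacc f t) 0.
  apply: (wacc_eq0 (k := scalar_curv (metric d) y / n.-1%:R)
    oI fs f_gt0 heps p1 Ot) => t' Ot' wt'.
  pose al s := scalar_curv (metric d) y / n.-1%:R
    + eps * (n.-1%:R * wacc f s - (n.-1%:R - 1) * wsq f s).
  pose be s := eps * wacc f s * (scalar_curv (metric d) y / n.-1%:R)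
    + (n.-1%:R - 1) * (wacc f s * (wacc f s - wsq f s)).
  (* The equations at [t'] and [t] share their quadratic term, so their difference is linear in the
     trace-free operator and its coefficients vanish. *)
  have [|A0 B0] := @trless_free _ _ p0 _ _ hs _ Oy (al t' - al t) (be t' - be t) Pn.
    move=> u v; apply: (eq_combination (k := 1) (etrans (Q t' Ot' wt' u v) (esym (Q t Ot wt u v)))).
    rewrite -/(al t') -/(al t) -/(be t') -/(be t); move: (al t') (al t) (be t') (be t).
    by generalize_atoms => *; ring.
  by split; exact: subr0_eq.
have [a [b ab]] := warping_square oI fs f_gt0 (connected_chart_img cc) w0.
exists a, b => d ad z [[Uz _] _] gt y.
have hs := chart_smooth_metric ad.
have [[zc zd] ex] := Uz; rewrite /= in zc zd.
pose x := prod_coord c d z.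
have xl : lsubmx x = chart_coord c z.1 by rewrite row_mxKl.
have xr : rsubmx x = y by rewrite row_mxKr.
have x1 : chart_img c (lsubmx x) by rewrite xl; exists z.1.
have x2 : chart_img d (rsubmx x) by rewrite xr; exists z.2.
have Oy : chart_img d y by exists z.2.
have [ft wt] := ab _ x1.
have [Lz PB] := flat_condition p2 heps gbs gbE fs f_gt0 hs x1 x2
  (fun _ => hL c d ac ad z Uz) (w0 _ x1) ex.
split.
- by rewrite Lz nE div1r; congr (_^-1); ring.
- by rewrite -xl -ft xl /f/= chart_coordK// inE.
- move=> mu be ga de; rewrite nE addrK.
  (* [wt] turns the factor eps v of the identity for the fiber into eps a^2. *)
  rewrite wt xr in PB.
  apply: etrans (fiber_identity p0 hs Oy PB mu be ga de) _.
  congr (_ + _ - _ / _ * _); exact: mulrAC.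
Qed.
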